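(* Let $F:\mathbb{N}\to\mathbb{C}$ satisfy $F(n)\ll_\varepsilon n^\varepsilon$ for every $\varepsilon>0$, and fix an integer $V>1$. Let $F_{(V)}(n)=\sum_{d\mid n,\ d\in(V)}F'(d)$. Then: (i) for every $\ell\in\mathbb{N}$, $\mathrm{Car}_\ell(F_{(V)})$ and $\mathrm{Win}_\ell(F_{(V)})$ exist and $\mathrm{Car}_\ell(F_{(V)})=\mathrm{Win}_\ell(F_{(V)})$; in particular both vanish for every $\ell\notin(V)$; (ii) for every $\ell\in\mathbb{N}$, $\sum_{t\in(V)}|F(t)c_\ell(t)|/t<\infty$, and for every $\ell\in(V)$, $$\mathrm{Car}_\ell(F_{(V)})=\prod_{p\le V}\Big(1-\frac1p\Big)\frac{1}{\varphi(\ell)}\sum_{t\in(V)}\frac{F(t)c_\ell(t)}{t};$$ (iii) for every $a\in\mathbb{N}$, $$F_{(V)}(a)=\sum_{\ell\in(V)}\Big(\prod_{p\le V}\Big(1-\frac1p\Big)\frac{1}{\varphi(\ell)}\sum_{t\in(V)}\frac{F(t)c_\ell(t)}{t}\Big)c_\ell(a)=\sum_{\ell\in(V)}\Big(\sum_{d\in(V),\ \ell\mid d}\frac{F'(d)}{d}\Big)c_\ell(a),$$ with convergent series; in particular the same two expansions hold with $F(a)$ in place of $F_{(V)}(a)$ for every $a\in(V)$; (iv) the coefficients $\widehat{F_{(V)}}(\ell):=\mathrm{Car}_\ell(F_{(V)})=\mathrm{Win}_\ell(F_{(V)})$ satisfy $\sum_{\ell=1}^\infty 2^{\omega(\ell)}|\widehat{F_{(V)}}(\ell)|<\infty$;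 (v) if $R:\mathbb{N}\to\mathbb{C}$ satisfies $F_{(V)}(a)=\sum_{\ell=1}^\infty R(\ell)c_\ell(a)$ for all $a\in\mathbb{N}$ and $\sum_{\ell=1}^\infty 2^{\omega(\ell)}|R(\ell)|<\infty$, then $R(\ell)=\widehat{F_{(V)}}(\ell)$ for all $\ell\in\mathbb{N}$.
   Context: $p$ denotes primes. For $V\in\mathbb{N}$, $(V)=\{n\in\mathbb{N}: n=1 \text{ or every prime } p\mid n \text{ satisfies } p\le V\}$ is the set of $V$-smooth numbers. $\mu$ is the Möbius function, $\varphi$ Euler's function, $\omega(n)$ the number of distinct prime factors of $n$, and $c_q(n)=\sum_{1\le j\le q,\ (j,q)=1}e^{2\pi i jn/q}$ the Ramanujan sum. For $F:\mathbb{N}\to\mathbb{C}$, $F'=F\ast\mu$ (Dirichlet convolution), i.e. $F'(d)=\sum_{t\mid d}F(t)\mu(d/t)$. Carmichael coefficients: $\mathrm{Car}_q(F)=\frac{1}{\varphi(q)}\lim_{x\to\infty}\frac1x\sum_{n\le x}F(n)c_q(n)$; Wintner coefficients: $\mathrm{Win}_q(F)=\sum_{d\ge1,\ q\mid d}F'(d)/d$. Note that $(F_{(V)})'=F'\cdot\mathbf{1}_{(V)}$. *)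

(* Defs.v *)
From HB Require Import structures.
From mathcomp Require Import all_boot all_order all_algebra.
From mathcomp Require Import all_classical all_reals all_analysis.
From mathcomp Require Import complex.

Set Implicit Arguments.
Unset Strict Implicit.
Unset Printing Implicit Defensive.

Import Order.TTheory GRing.Theory Num.Theory.
Import numFieldNormedType.Exports.

Local Open Scope classical_set_scope.
Local Open Scope complex_scope.
Local Open Scope ring_scope.

(* The positive integers are the n : nat with 0 < n. Arithmetic functions are
   total functions on nat whose value at 0 is never used: sums start at 1 or
   range over divisors of a positive integer. *)

(* [primes 0] is empty, whence the explicit positivity condition. *)
Definition smooth (V n : nat) : bool :=
  (0 < n)%N && all (fun p => (p <= V)%N) (primes n).

Definition omega (n : nat) : nat := size (primes n).

Definition mobius (n : nat) : int :=
  if (0 < n)%N && all (fun p => logn p n == 1%N) (primes n)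
  then (-1) ^+ omega n else 0.

Section Arithmetic.
Variable R : realType.
Implicit Types (F : nat -> R[i]) (V q n d : nat).

Definition expi (x : R) : R[i] := cos x +i* sin x.

Definition ramanujan_sum (q n : nat) : R[i] :=
  \sum_(1 <= j < q.+1 | coprime j q) expi (2 * pi * j%:R * n%:R / q%:R).

(* The Dirichlet convolution F' of F with the Moebius function. *)
Definition eratosthenes F d : R[i] :=
  \sum_(t <- divisors d) F t * (mobius (d %/ t))%:~R.

Definition smooth_part F V n : R[i] :=
  \sum_(d <- divisors n | smooth V d) eratosthenes F d.

(* F(n) << n^eps for every eps > 0, with constant depending on eps. *)
Definition subpolynomial F : Prop :=
  forall eps : R, 0 < eps ->
    exists C : R, forall n, (0 < n)%N ->
      Normc.normc (F n) <= C * n%:R `^ eps.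

(* R[i] carries its normed topology through the alias R[i]^o. Series over a
   set of positive integers are summed in increasing order of the index; [finite_sum] is only meant for
   nonnegative terms. *)
Definition partial_sum (P : pred nat) (u : nat -> R[i]) (N : nat) : R[i]^o :=
  \sum_(1 <= n < N.+1 | P n) u n.

Definition series_cvg (P : pred nat) (u : nat -> R[i]) : Prop :=
  cvgn (partial_sum P u).

Definition series_sum (P : pred nat) (u : nat -> R[i]) : R[i] :=
  limn (partial_sum P u).

Definition series_to (P : pred nat) (u : nat -> R[i]) (s : R[i]) : Prop :=
  partial_sum P u @ \oo --> (s : R[i]^o).

Definition finite_sum (P : pred nat) (u : nat -> R) : Prop :=
  (\sum_(1 <= n <oo | P n) (u n)%:E < +oo)%E.

Definition carmichael_mean q F (x : R) : R[i]^o :=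
  (x^-1)%:C * \sum_(1 <= n < (Num.truncn x).+1) F n * ramanujan_sum q n.

Definition Car_exists q F : Prop := cvg (carmichael_mean q F x @[x --> +oo]).

Definition Car q F : R[i] :=
  (totient q)%:R^-1 * lim (carmichael_mean q F x @[x --> +oo]).

Definition Win_exists q F : Prop :=
  series_cvg (fun d => (q %| d)%N) (fun d => eratosthenes F d / d%:R).

Definition Win q F : R[i] :=
  series_sum (fun d => (q %| d)%N) (fun d => eratosthenes F d / d%:R).

Definition euler_factor V : R[i] :=
  \prod_(1 <= p < V.+1 | prime p) (1 - p%:R^-1).

End Arithmetic.

(* Main.v *)
Require Import Defs.
From HB Require Import structures.
From mathcomp Require Import all_boot all_order all_algebra.
From mathcomp Require Import all_classical all_reals all_analysis.
From mathcomp Require Import complex.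
From mathcomp Require Import cyclic ring lra.
Import Order.TTheory GRing.Theory Num.Theory.
Import numFieldNormedType.Exports.
Local Open Scope classical_set_scope.
Local Open Scope complex_scope.
Local Open Scope ring_scope.

(** Moebius inversion gives [c_l(n) = \sum_(g | l, g | n) mu(l/g) g] and
    [\sum_(l | d) c_l(a) = d 1_(d | a)]. On smooth numbers
    [F'(d)/d = O(d^(-1/2))], a bound which is completely multiplicative and
    summable, so the Wintner coefficients exist, are [O(l^(-1/2))] on smooth [l]
    and vanish elsewhere; this is (iv). Every interchange of limits is an
    instance of Tannery's theorem:
    - expanding [F_(V)(a) = \sum_d F'(d)/d \sum_(l | d) c_l(a)] and letting the
      cut-off on [d] tend to infinity gives (iii);
    - writing [F = 1 * F'] in [\sum_t F(t) c_l(t)/t], the inner sum over smooth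
      [m] of [c_l(dm)/m] is [phi(l) 1_(l | d) \prod_(p <= V) (1 - 1/p)^-1],
      which gives (ii);
    - if [H = \sum_l G(l) c_l] pointwise with [\sum_l 2^omega(l) |G(l)|] finite,
      then, as the mean of [|c_l|] is at most [2^omega(l)], the mean of
      [H c_q] may be taken termwise and orthogonality leaves [phi(q) G(q)].
      Applied to (iii) this gives (i), and applied to an arbitrary [G] it
      gives (v). *)

(** * Divisor sums and Moebius inversion *)

Lemma sum_divisors (M : nmodType) (h : nat -> M) (n N : nat) :
  (0 < n <= N)%N ->
  \sum_(d <- divisors n) h d = \sum_(1 <= d < N.+1 | (d %| n)%N) h d.
Proof.
case/andP=> n_gt0 leN; rewrite -[RHS]big_filter; apply: perm_big.
apply: uniq_perm; rewrite ?divisors_uniq ?filter_uniq ?iota_uniq // => d.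
rewrite -dvdn_divisors // mem_filter mem_index_iota ltnS.
case: (boolP (d %| n)%N) => //= dn.
by rewrite (dvdn_gt0 n_gt0 dn) (leq_trans (dvdn_leq n_gt0 dn)).
Qed.

Lemma sum_multiples (M : nmodType) (h : nat -> M) (e N : nat) : (0 < e)%N ->
  \sum_(1 <= n < N.+1 | (e %| n)%N) h n =
  \sum_(1 <= m < (N %/ e).+1) h (e * m)%N.
Proof.
move=> e_gt0; elim: N => [|N IH]; first by rewrite div0n !big_geq.
rewrite big_mkcond big_nat_recr //= -big_mkcond IH divnS //=.
case: (boolP (e %| N.+1)%N) => [dvdeN|]; last by rewrite addr0.
rewrite add1n [RHS]big_nat_recr //=; congr (_ + h _).
have := divnK dvdeN; rewrite divnS // dvdeN add1n mulnC => -> //.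
Qed.

Lemma sum_multiples_cond (M : nmodType) (h : nat -> M) (P : pred nat)
    (e N : nat) : (0 < e)%N ->
  \sum_(1 <= n < N.+1 | (e %| n)%N && P n) h n =
  \sum_(1 <= m < (N %/ e).+1 | P (e * m)%N) h (e * m)%N.
Proof.
by move=> e_gt0; rewrite big_mkcondr sum_multiples // [RHS]big_mkcond.
Qed.

(** Each pair d | t is recorded as t = d m, so the cut-off t <= N becomes m <= N / d. *)
Lemma sum_divisors_exchange (M : nmodType) (h : nat -> nat -> M) (N : nat) :
  \sum_(1 <= t < N.+1) \sum_(d <- divisors t) h d t =
  \sum_(1 <= d < N.+1) \sum_(1 <= m < (N %/ d).+1) h d (d * m)%N.
Proof.
transitivity (\sum_(1 <= t < N.+1) \sum_(1 <= d < N.+1 | (d %| t)%N) h d t).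
  by apply: eq_big_nat => t tN; apply: sum_divisors.
rewrite (exchange_big_dep xpredT) //=.
by apply: eq_big_nat => d /andP[d_gt0 _]; rewrite sum_multiples.
Qed.

(** Substituting d = t e turns a chain t | d | n into e | n / t; both directions of Moebius
    inversion rest on this. *)
Lemma sum_divisors2 (M : nmodType) (h : nat -> nat -> M) (n : nat) :
  (0 < n)%N ->
  \sum_(d <- divisors n) \sum_(t <- divisors d) h t d =
  \sum_(t <- divisors n) \sum_(e <- divisors (n %/ t)) h t (t * e)%N.
Proof.
move=> n_gt0.
rewrite (@sum_divisors _ _ n n) ?n_gt0 ?leqnn //.
rewrite [RHS](@sum_divisors _ _ n n) ?n_gt0 ?leqnn //.
transitivity (\sum_(1 <= d < n.+1 | (d %| n)%N)
    \sum_(1 <= t < n.+1 | (t %| d)%N) h t d).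
  rewrite big_nat_cond [RHS]big_nat_cond; apply: eq_bigr => d.
  by case/andP=> dn _; apply: sum_divisors.
rewrite (exchange_big_dep (fun t => (t %| n)%N)) /=; last first.
  by move=> d t dn /dvdn_trans; apply.
rewrite big_nat_cond [RHS]big_nat_cond; apply: eq_bigr => t.
case/andP=> /andP[t_gt0 _] tn.
have q_gt0 : (0 < n %/ t)%N by rewrite divn_gt0 // dvdn_leq.
rewrite (@sum_divisors _ _ (n %/ t) (n %/ t)) ?q_gt0 ?leqnn //.
under eq_bigl do rewrite andbC.
rewrite sum_multiples_cond //; apply: eq_bigl => m.
by rewrite dvdn_divRL // mulnC.
Qed.

Lemma perm_divisors_compl (n : nat) : (0 < n)%N ->
  perm_eq [seq (n %/ d)%N | d <- divisors n] (divisors n).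
Proof.
move=> n_gt0.
have divK d : (d %| n)%N -> (n %/ (n %/ d))%N = d.
  move=> dn; have d_gt0 := dvdn_gt0 n_gt0 dn.
  by rewrite -{1}(divnK dn) mulKn // divn_gt0 // dvdn_leq.
apply: uniq_perm; [|exact: divisors_uniq|].
  rewrite map_inj_in_uniq ?divisors_uniq // => a b; 
  rewrite -!dvdn_divisors // => an bn eq_ab.
  by rewrite -(divK _ an) eq_ab divK.
move=> d; apply/mapP/idP => [[e]|].
  rewrite -!dvdn_divisors // => en ->; apply/dvdnP; exists e.
  by rewrite mulnC divnK.
rewrite -dvdn_divisors // => dn; exists (n %/ d)%N; last by rewrite divK.
by rewrite -dvdn_divisors // dvdn_div.
Qed.

Lemma sum_divisors_compl (M : nmodType) (h : nat -> M) (n : nat) : (0 < n)%N ->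
  \sum_(d <- divisors n) h (n %/ d)%N = \sum_(d <- divisors n) h d.
Proof.
move=> n_gt0; rewrite -[LHS](big_map (fun d => n %/ d)%N xpredT h).
exact: perm_big (perm_divisors_compl n n_gt0).
Qed.

Lemma mobius_square (p d : nat) : prime p -> (p * p %| d)%N -> mobius d = 0.
Proof.
move=> p_pr; rewrite /mobius; case: d => // d ppd.
have : (2 <= logn p d.+1)%N by rewrite -pfactor_dvdn // expnS expn1.
move=> lp; case: ifP => // /allP/(_ p).
by rewrite -logn_gt0 => /(_ (ltnW lp)) /eqP e; rewrite e in lp.
Qed.

Lemma perm_primes_pmul (p d : nat) : prime p -> (0 < d)%N -> ~~ (p %| d)%N ->
  perm_eq (primes (p * d)) (p :: primes d).
Proof.
move=> p_pr d_gt0 pd; apply: uniq_perm; rewrite ?primes_uniq //=.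
  by rewrite primes_uniq mem_primes p_pr d_gt0 pd.
by move=> q; rewrite primesM ?(prime_gt0 p_pr) // primes_prime // mem_seq1 in_cons.
Qed.

Lemma mobius_pmul (p d : nat) : prime p -> (0 < d)%N -> ~~ (p %| d)%N ->
  mobius (p * d) = - mobius d.
Proof.
move=> p_pr d_gt0 pd; have pe := @perm_primes_pmul p d p_pr d_gt0 pd.
rewrite /mobius /omega (perm_size pe) (perm_all _ pe) muln_gt0 prime_gt0 // d_gt0 /=.
rewrite lognM ?(prime_gt0 p_pr) // logn_prime // eqxx lognE p_pr d_gt0 (negbTE pd) /=.
have -> : all (fun q => logn q (p * d) == 1%N) (primes d) =
          all (fun q => logn q d == 1%N) (primes d).
  apply: eq_in_all => q; rewrite mem_primes => /and3P[q_pr _ qd].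
  rewrite lognM ?(prime_gt0 p_pr) // logn_prime //.
  by case: (eqVneq q p) => // eqp; rewrite -eqp qd in pd.
by case: ifP; rewrite ?oppr0 // exprS mulN1r.
Qed.

(** Only divisors of p-adic valuation 0 or 1 survive, namely d and p d for d | m. Moebius sums are
    thereby computed by removing one prime at a time. *)
Lemma sum_divisors_pfactor (M : nmodType) (h : nat -> M) (p a m : nat) :
  prime p -> (0 < m)%N -> ~~ (p %| m)%N ->
  (forall d, (p * p %| d)%N -> h d = 0) ->
  \sum_(d <- divisors (p ^ a.+1 * m)) h d =
  \sum_(d <- divisors m) (h d + h (p * d)%N).
Proof.
move=> p_pr m_gt0 pm h0; have p_gt0 := prime_gt0 p_pr.
have n_gt0 : (0 < p ^ a.+1 * m)%N by rewrite muln_gt0 expn_gt0 p_gt0.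
set n := (p ^ a.+1 * m)%N in n_gt0 *.
have mq : (m <= n %/ p)%N.
  by rewrite /n expnS -mulnA mulKn // leq_pmull // expn_gt0 p_gt0.
have mn : (m <= n)%N by rewrite (leq_trans mq) // leq_div.
have cop d : ~~ (p %| d)%N -> coprime d (p ^ a.+1).
  by move=> pd; rewrite coprimeXr // coprime_sym prime_coprime.
rewrite (@sum_divisors _ _ n n) ?n_gt0 ?leqnn // big_split /=.
(* The divisors prime to p are those of m; the others are p d, and the terms with p | d vanish by
   [h0]. *)
rewrite (bigID (fun d => (p %| d)%N)) /= addrC; congr (_ + _).
  rewrite (@sum_divisors _ _ m n) ?m_gt0 //; apply: eq_bigl => d.
  case: (boolP (p %| d)%N) => pd; rewrite ?(andbF, andbT).
    by apply/esym/negbTE; apply: contra pm; apply: dvdn_trans.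
  by rewrite Gauss_dvdr // cop.
under eq_bigl do rewrite andbC.
rewrite sum_multiples_cond // (bigID (fun d => (p %| d)%N)) /= big1 ?add0r.
  rewrite (@sum_divisors _ _ m (n %/ p)) ?m_gt0 //; apply: eq_bigl => d.
  case: (boolP (p %| d)%N) => pd; rewrite ?(andbF, andbT).
    by apply/esym/negbTE; apply: contra pm; apply: dvdn_trans.
  rewrite /n expnS -mulnA dvdn_pmul2l // Gauss_dvdr //.
  by rewrite coprimeXr // coprime_sym prime_coprime.
by move=> d /andP[_ pd]; apply: h0; rewrite dvdn_pmul2l.
Qed.

Lemma prime_power_split (n : nat) : (1 < n)%N ->
  exists p a m, [/\ prime p, (0 < m)%N, ~~ (p %| m)%N & n = (p ^ a.+1 * m)%N].
Proof.
move=> n_gt1; have n_gt0 := ltnW n_gt1.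
have p_pr := pdiv_prime n_gt1; have lp : (0 < logn (pdiv n) n)%N.
  by rewrite logn_gt0 mem_primes p_pr n_gt0 pdiv_dvd.
have [m pm eqn] := pfactor_coprime p_pr n_gt0.
exists (pdiv n), (logn (pdiv n) n).-1, m; rewrite prednK // mulnC; split=> //.
  by case: m eqn pm n_gt0 => // -> ; rewrite mul0n.
by rewrite -prime_coprime.
Qed.

(** With n = p^(a+1) m, the terms at d and p d cancel. *)
Lemma sum_mobius (n : nat) : (0 < n)%N ->
  \sum_(d <- divisors n) mobius d = (n == 1%N)%:R.
Proof.
case: n => [//|[_|n _]]; first by rewrite big_seq1.
have [p [a [m [p_pr m_gt0 pm ->]]]] := @prime_power_split n.+2 isT.
rewrite sum_divisors_pfactor //; last by move=> d; apply: mobius_square.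
rewrite big_seq_cond big1 ?gtn_eqF //.
- rewrite (leq_trans (prime_gt1 p_pr)) // expnS -mulnA leq_pmulr //.
  by rewrite muln_gt0 expn_gt0 prime_gt0.
move=> d; rewrite -dvdn_divisors // andbT => dm.
rewrite mobius_pmul ?subrr //; first exact: dvdn_gt0 dm.
by apply: contra pm => /dvdn_trans; apply.
Qed.

(** With n = p^(a+1) m, the terms at d and p d are equal, so each prime factor doubles the sum. *)
Lemma sum_norm_mobius (n : nat) : (0 < n)%N ->
  \sum_(d <- divisors n) `|mobius d| = 2 ^+ omega n.
Proof.
elim/ltn_ind: n => -[//|[_ _|n IH _]]; first by rewrite big_seq1.
have [p [a [m [p_pr m_gt0 pm eqn]]]] := @prime_power_split n.+2 isT.
have p_gt0 := prime_gt0 p_pr.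
have omn : omega n.+2 = (omega m).+1.
  rewrite /omega -[RHS](perm_size (perm_primes_pmul _ _ p_pr m_gt0 pm)).
  congr size; apply/eq_primes => q.
  by rewrite eqn !primesM ?expn_gt0 ?p_gt0 // primesX.
have lt_mn : (m < n.+2)%N.
  rewrite eqn ltn_Pmull // (leq_trans (prime_gt1 p_pr)) // expnS leq_pmulr //.
  by rewrite expn_gt0 p_gt0.
rewrite omn {1}eqn sum_divisors_pfactor //; last first.
  by move=> d /(mobius_square _ _ p_pr) ->; rewrite normr0.
rewrite exprS -(IH m) // mulr_sumr big_seq [RHS]big_seq; apply: eq_bigr => d.
rewrite -dvdn_divisors // => dm.
rewrite mobius_pmul ?normrN ?mulr_natl ?mulr2n //; first exact: dvdn_gt0 dm.
by apply: contra pm => /dvdn_trans; apply.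
Qed.

Lemma norm_mobius_le1 (n : nat) : `|mobius n| <= 1.
Proof. by rewrite /mobius; case: ifP; rewrite ?normr0 // normrX normrN1 expr1n. Qed.

Lemma sum_divisors_mobius (T : pzRingType) (n : nat) : (0 < n)%N ->
  \sum_(d <- divisors n) (mobius d)%:~R = (n == 1%N)%:R :> T.
Proof.
by move=> n_gt0; rewrite -(rmorph_sum (intmul 1)) /= sum_mobius //; case: eqP.
Qed.

Section Eratosthenes.
Variable R : realType.
Implicit Types (F h : nat -> R[i]).

(** After the exchange, F(t) is multiplied by the Moebius sum over the divisors of n / t, which is
    zero unless t = n. *)
Lemma sum_eratosthenes F (n : nat) : (0 < n)%N ->
  \sum_(d <- divisors n) eratosthenes F d = F n.
Proof.
move=> n_gt0; rewrite /eratosthenes.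
rewrite (sum_divisors2 _ (fun t d => F t * (mobius (d %/ t))%:~R)) //.
rewrite (bigD1_seq n) ?divisors_id ?divisors_uniq //= divnn n_gt0.
rewrite big_seq1 muln1 divnn n_gt0 mulr1 big_seq_cond big1 ?addr0 // => t.
rewrite -dvdn_divisors // => /andP[tn ne_tn].
have t_gt0 := dvdn_gt0 n_gt0 tn.
have q_gt0 : (0 < n %/ t)%N by rewrite divn_gt0 // dvdn_leq.
under eq_bigr do rewrite mulKn //.
rewrite -mulr_sumr sum_divisors_mobius //.
case: eqP => [e|]; last by rewrite mulr0.
by move: ne_tn; rewrite -(divnK tn) e mul1n eqxx.
Qed.

(** The converse inversion, with its hypothesis asked only at divisors of n, which are positive.
    Every explicit transform below is identified through it. *)
Lemma eratosthenes_sum F h (n : nat) : (0 < n)%N ->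
  (forall m, (m %| n)%N -> F m = \sum_(d <- divisors m) h d) ->
  eratosthenes F n = h n.
Proof.
move=> n_gt0 Fh; rewrite /eratosthenes.
transitivity (\sum_(t <- divisors n) \sum_(d <- divisors t)
   h d * (mobius (n %/ t))%:~R).
  rewrite big_seq [RHS]big_seq; apply: eq_bigr => t.
  by rewrite -dvdn_divisors // => tn; rewrite Fh // mulr_suml.
rewrite (sum_divisors2 _ (fun d t => h d * (mobius (n %/ t))%:~R)) //.
rewrite (bigD1_seq n) ?divisors_id ?divisors_uniq //= divnn n_gt0.
rewrite big_seq1 muln1 divnn n_gt0 mulr1 big_seq_cond big1 ?addr0 // => t.
rewrite -dvdn_divisors // => /andP[tn ne_tn].
have t_gt0 := dvdn_gt0 n_gt0 tn.
have q_gt0 : (0 < n %/ t)%N by rewrite divn_gt0 // dvdn_leq.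
(* As n / (t e) = (n / t) / e, passing to complementary divisors yields the Moebius sum over the
   divisors of n / t. *)
under eq_bigr do rewrite divnMA.
rewrite -mulr_sumr (sum_divisors_compl _ (fun e => (mobius e)%:~R)) //.
rewrite sum_divisors_mobius //.
case: eqP => [e|]; last by rewrite mulr0.
by move: ne_tn; rewrite -(divnK tn) e mul1n eqxx.
Qed.

Lemma sum_totient (n : nat) : (0 < n)%N ->
  (\sum_(d <- divisors n) totient d = n)%N.
Proof.
move=> n_gt0; rewrite (@sum_divisors nat _ n n) ?n_gt0 ?leqnn //.
rewrite -[RHS]sum_totient_dvd -(big_mkord (fun d => (d %| n)%N)).
by rewrite [RHS]big_ltn_cond // dvd0n gtn_eqF.
Qed.

(** Since gcd(m, d) is the sum of phi(e) over the common divisors e of m and d, inversion in m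
    isolates the term e = l. This serves both orthogonality and the series over smooth m. *)
Lemma eratosthenes_gcd (l d : nat) : (0 < l)%N ->
  eratosthenes (fun g => (gcdn g d)%:R : R[i]) l = (totient l * (l %| d)%N)%:R.
Proof.
move=> l_gt0.
apply: (@eratosthenes_sum _ (fun l => (totient l * (l %| d)%N)%:R)) => // m ml.
have m_gt0 := dvdn_gt0 l_gt0 ml.
have g_gt0 : (0 < gcdn m d)%N by rewrite gcdn_gt0 m_gt0.
rewrite -{1}(sum_totient _ g_gt0) natr_sum.
have le_gm : (gcdn m d <= m)%N by rewrite dvdn_leq // dvdn_gcdl.
rewrite (@sum_divisors _ _ _ m) ?g_gt0 //.
rewrite (@sum_divisors _ _ m m) ?m_gt0 ?leqnn //.
rewrite big_mkcond [RHS]big_mkcond; apply: eq_bigr => e _.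
by rewrite dvdn_gcd; case: (e %| m)%N => //=; case: (e %| d)%N; rewrite ?muln1 ?muln0.
Qed.

Lemma smooth_mul (V m n : nat) : smooth V (m * n) = smooth V m && smooth V n.
Proof.
rewrite /smooth muln_gt0; case: posnP => //= m_gt0.
case: posnP => n_gt0 /=; first by rewrite andbF.
rewrite -all_cat; apply: eq_all_r => p.
by rewrite mem_cat primesM.
Qed.

Lemma smooth_dvd (V d n : nat) : (d %| n)%N -> smooth V n -> smooth V d.
Proof. by case/dvdnP=> k ->; rewrite smooth_mul => /andP[]. Qed.

Lemma eratosthenes_smooth_part F (V n : nat) : (0 < n)%N ->
  eratosthenes (smooth_part F V) n =
  if smooth V n then eratosthenes F n else 0.
Proof.
move=> n_gt0.
apply: (@eratosthenes_sum _ (fun n => if smooth V n then _ else 0)) => // m _.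
by rewrite /smooth_part big_mkcond.
Qed.

Lemma smooth_part_smooth F (V a : nat) : smooth V a -> smooth_part F V a = F a.
Proof.
move=> sa; have a_gt0 : (0 < a)%N by case/andP: sa.
rewrite /smooth_part -[RHS]sum_eratosthenes // big_seq_cond [RHS]big_seq.
apply: eq_bigl => d; case: (boolP (d \in _)) => //=.
by rewrite -dvdn_divisors // => /smooth_dvd; apply.
Qed.

End Eratosthenes.

(** * Ramanujan sums *)

Section Ramanujan.
Variable R : realType.

Lemma expiD (x y : R) : expi (x + y) = expi x * expi y.
Proof.
rewrite /expi cosD sinD; apply/eqP; rewrite eq_complex /= eqxx /=.
by rewrite addrC.
Qed.

Lemma expi0 : expi (0 : R) = 1.
Proof. by rewrite /expi cos0 sin0. Qed.

Lemma expi_natmul (x : R) (n : nat) : expi (n%:R * x) = expi x ^+ n.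
Proof.
elim: n => [|n IH]; first by rewrite mul0r expi0 expr0.
by rewrite -natr1 mulrDl mul1r expiD IH exprSr.
Qed.

Lemma expi_2pi : expi (2 * pi : R) = 1.
Proof. by rewrite /expi mulr_natl cos2pi sin2pi. Qed.

(** Here cos x = 1 - 2 sin(x/2)^2, and sin(x/2) > 0 on this range. *)
Lemma expi_neq1 (x : R) : 0 < x < 2 * pi -> expi x != 1.
Proof.
move=> /andP[x0 x2]; rewrite eq_complex /= negb_and; apply/orP; left.
have -> : x = (x / 2) *+ 2 by rewrite -mulr_natr divfK ?pnatr_eq0.
have : 0 < sin (x / 2) by apply: sin_gt0_pi; lra.
move=> s0; rewrite cos_mulr2n cos2sin2.
have := mulr_gt0 s0 s0; rewrite -expr2; set s := sin _ ^+ 2 => hs.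
by apply/eqP; rewrite mulr2n; lra.
Qed.

(** A geometric sum whose ratio z is a d-th root of unity, equal to 1 exactly when d | a. *)
Lemma sum_expi (d a : nat) : (0 < d)%N ->
  \sum_(1 <= j < d.+1) expi (2 * pi * j%:R * a%:R / d%:R : R) =
  (d * (d %| a))%:R.
Proof.
move=> d_gt0; have dR : d%:R != 0 :> R by rewrite pnatr_eq0 -lt0n.
pose z : R[i] := expi (2 * pi * a%:R / d%:R).
have E j : expi (2 * pi * j%:R * a%:R / d%:R : R) = z ^+ j.
  by rewrite -expi_natmul; congr expi; ring.
under eq_bigr do rewrite E.
(* Reducing a modulo d puts the angle in [0, 2 pi), as [expi_neq1] requires when d does not divide
   a. *)
have zE : z = expi (2 * pi * (a %% d)%:R / d%:R).
  rewrite /z {1}(divn_eq a d) natrD natrM mulrDr mulrDl expiD.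
  have -> : 2 * pi * ((a %/ d)%:R * d%:R) / d%:R = (a %/ d)%:R * (2 * pi) :> R.
    by field.
  by rewrite expi_natmul expi_2pi expr1n mul1r.
case: (boolP (d %| a)%N) => [/eqP da|da].
  rewrite zE da mulr0 mul0r expi0 muln1.
  under eq_bigr do rewrite expr1n.
  by rewrite sumr_const_nat subSS subn0.
have z1 : z - 1 != 0.
  rewrite subr_eq0 zE; apply: expi_neq1; have p0 := pi_gt0 R.
  have d0 : 0 < d%:R :> R by rewrite ltr0n.
  rewrite -mulrA !mulr_gt0 //= ?invr_gt0 ?ltr0n // ?lt0n //.
  by rewrite -[ltRHS]mulr1 ltr_pM2l ?mulr_gt0 // ltr_pdivrMr // mul1r ltr_nat ltn_mod.
rewrite /= muln0; apply: (mulfI z1); rewrite mulr0 mulr_sumr.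
under eq_bigr do rewrite mulrBl mul1r -exprS.
rewrite telescope_sumr // expr1 exprSr.
suff -> : z ^+ d = 1 by rewrite mul1r subrr.
rewrite -expi_natmul.
have -> : d%:R * (2 * pi * a%:R / d%:R) = a%:R * (2 * pi) :> R by field.
by rewrite expi_natmul expi_2pi expr1n.
Qed.

(** Sort the j by g = gcd(j, d) and write j = g i: then i is coprime to d / g, and the class sums to
    the Ramanujan sum of modulus d / g. *)
Lemma sum_ramanujan (d a : nat) : (0 < d)%N ->
  \sum_(l <- divisors d) ramanujan_sum R l a = (d * (d %| a))%:R.
Proof.
move=> d_gt0; rewrite -sum_expi //.
transitivity (\sum_(1 <= j < d.+1) \sum_(g <- divisors d | g == gcdn j d)
    expi (2 * pi * j%:R * a%:R / d%:R : R)); last first.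
  apply: eq_bigr => j _; rewrite -big_filter filter_pred1_uniq ?divisors_uniq //.
    by rewrite big_seq1.
  by rewrite -dvdn_divisors // dvdn_gcdr.
rewrite (exchange_big_dep xpredT) //= -sum_divisors_compl //.
rewrite big_seq [RHS]big_seq; apply: eq_bigr => g; rewrite -dvdn_divisors // => gd.
have g_gt0 := dvdn_gt0 d_gt0 gd.
have dE : d = (g * (d %/ g))%N by rewrite mulnC divnK.
have q_gt0 : (0 < d %/ g)%N by rewrite divn_gt0 // dvdn_leq.
rewrite (eq_bigl (fun j => (g %| j)%N && (g == gcdn j d))); last first.
  move=> j; case: eqVneq => [->|]; rewrite ?andbF ?andbT //.
  by rewrite dvdn_gcdl.
rewrite sum_multiples_cond //; apply: eq_big => i.
  by rewrite [in RHS]dE -muln_gcdr -[X in X == _]muln1 eqn_pmul2l //.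
move=> _; congr expi; rewrite [in RHS]dE !natrM.
have : g%:R != 0 :> R by rewrite pnatr_eq0 -lt0n.
have : (d %/ g)%:R != 0 :> R by rewrite pnatr_eq0 -lt0n.
by move=> *; field; apply/andP.
Qed.

Lemma ramanujan_sumE (l n : nat) : (0 < l)%N ->
  ramanujan_sum R l n = eratosthenes (fun g => (g * (g %| n))%:R) l.
Proof.
move=> l_gt0; apply/esym.
apply: (@eratosthenes_sum _ _ (fun l => ramanujan_sum R l n)) => // m ml.
by rewrite sum_ramanujan // (dvdn_gt0 l_gt0).
Qed.

End Ramanujan.

(** * Absolutely convergent complex series *)

Section ComplexSeries.
Variable R : realType.
Implicit Types (u v : nat -> R[i]) (M : nat -> R) (P : pred nat).
Local Notation normc := (@Normc.normc R).
Local Notation Re := (@complex.Re R).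
Local Notation Im := (@complex.Im R).

Lemma norm_normc (z : R[i]) : `|z| = (normc z)%:C.
Proof. by case: z => a b; rewrite normc_def. Qed.

Lemma normc_ge0 (z : R[i]) : 0 <= normc z.
Proof. by case: z => a b; apply: sqrtr_ge0. Qed.

Lemma normc_sum (I : Type) (r : seq I) (Q : pred I) (f : I -> R[i]) :
  normc (\sum_(i <- r | Q i) f i) <= \sum_(i <- r | Q i) normc (f i).
Proof.
elim/big_rec2: _ => [|i y z _ le_zy]; first by rewrite Normc.normc0.
by apply: le_trans (le_normcD _ _) _; rewrite lerD2l.
Qed.

Lemma normc_real (x : R) : normc x%:C = `|x|.
Proof. by rewrite /= expr0n addr0 sqrtr_sqr. Qed.

Lemma normc_nat (n : nat) : normc n%:R = n%:R.
Proof. by rewrite -(rmorph_nat (real_complex R)) normc_real normr_nat. Qed.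

Lemma normc_int (n : int) : normc n%:~R = `|n|%:~R.
Proof. by rewrite -(rmorph_int (real_complex R)) normc_real intr_norm. Qed.

Lemma normc_le (a b : R) : normc (a +i* b) <= `|a| + `|b|.
Proof.
have nb : normc (0 +i* b) = `|b| by rewrite /= expr0n add0r sqrtr_sqr.
have -> : a +i* b = a%:C + (0 +i* b) by simpc.
by rewrite -nb -normc_real; apply: le_normcD.
Qed.

Lemma Re_le_normc (z : R[i]) : `|Re z| <= normc z.
Proof. by rewrite -lecR -norm_normc normc_ge_Re. Qed.

Lemma Im_le_normc (z : R[i]) : `|Im z| <= normc z.
Proof.
by case: z => a b /=; rewrite -(sqrtr_sqr b) ler_wsqrtr // lerDr sqr_ge0.
Qed.

(** The norm of [R[i]^o] takes values in [R[i]], where positive elements are real; this trades its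
    epsilons for elements of [R]. *)
Lemma cvg_normcP (T : Type) (Fil : set_system T) (FF : Filter Fil)
    (f : T -> R[i]^o) (l : R[i]) :
  (f @ Fil --> (l : R[i]^o)) <->
  (forall e : R, 0 < e -> \forall x \near Fil, normc (l - f x) <= e).
Proof.
split=> [/cvgrPdist_le fl e e0|fl].
  have := fl e%:C; rewrite ltcR => /(_ e0); apply: filterS => x.
  by rewrite norm_normc lecR.
apply/cvgrPdist_le => e e0; have eE : e = (Re e)%:C by rewrite RRe_real ?gtr0_real.
have := fl (Re e); rewrite -ltcR -eE => /(_ e0); apply: filterS => x.
by rewrite norm_normc [e]eE lecR.
Qed.

(** For nonnegative terms this is summability, kept as a uniform bound so that majorants compare
    term by term. *)
Definition bounded_sums M : Prop :=
  exists K, forall N : nat, \sum_(1 <= n < N.+1) M n <= K.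

Lemma finite_sum_bounded P M : (forall n, 0 <= M n) ->
  finite_sum P M <-> bounded_sums (fun n => if P n then M n else 0).
Proof.
move=> M0; split.
  rewrite /finite_sum => fin.
  exists (fine (\sum_(1 <= n <oo | P n) (M n)%:E)%E) => N.
  rewrite -lee_fin fineK; last first.
    by rewrite ge0_fin_numE // nneseries_ge0 // => n _ _; rewrite lee_fin.
  rewrite -sumEFin.
  apply: le_trans (nneseries_lim_ge N.+1 _); last by move=> *; rewrite lee_fin.
  by rewrite [leRHS]big_mkcond /=; apply: lee_sum => n _; case: ifP.
case=> K bK; apply: (@le_lt_trans _ _ K%:E); last exact: ltry.
apply: lime_le; first by apply: is_cvg_nneseries => n _ _; rewrite lee_fin.
(* The partial sums of the extended series run over n < N, so the cut-off 0 is a separate, empty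
   case. *)
apply: nearW => -[|N]; rewrite big_mkcond /=.
  by rewrite big_geq // lee_fin (le_trans _ (bK 0%N)) // big_geq.
apply: le_trans (_ : (\sum_(1 <= n < N.+1) (if P n then M n else 0))%:E <= _)%E;
  last by rewrite lee_fin.
by rewrite -sumEFin; apply: lee_sum => n _; case: ifP.
Qed.

Lemma bounded_sums_le (M M' : nat -> R) (k : R) : 0 <= k ->
  (forall n, (0 < n)%N -> M n <= k * M' n) ->
  bounded_sums M' -> bounded_sums M.
Proof.
move=> k0 MM' [K bK]; exists (k * K) => N.
apply: le_trans (ler_wpM2l k0 (bK N)); rewrite mulr_sumr big_nat [leRHS]big_nat.
by apply: ler_sum => n /andP[n0 _]; apply: MM'.
Qed.

(** A partial sum within e of the supremum of all of them leaves tails of at most e. *)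
Lemma bounded_sums_tail M : (forall n, (0 < n)%N -> 0 <= M n) ->
  bounded_sums M -> forall e : R, 0 < e ->
  exists N0 : nat, forall N, \sum_(N0.+1 <= n < N.+1) M n <= e.
Proof.
move=> M0 [K bK] e e0.
pose E := range (fun N => \sum_(1 <= n < N.+1) M n).
have supE : has_sup E.
  split; first by exists (\sum_(1 <= n < 1) M n), 0%N.
  by exists K => _ [N _ <-].
have [_ [N0 _ <-] ltN0] := sup_adherent e0 supE.
exists N0 => N; have [leN|ltN] := leqP N N0.
  by rewrite big_geq ?ltW.
have le_sup : \sum_(1 <= n < N.+1) M n <= sup E.
  by apply: ub_le_sup; [exact: supE.2|exists N].
rewrite (@big_cat_nat _ _ _ N0.+1) //= in le_sup; last exact: ltnW.
by move: ltN0 le_sup; set a := bigop _ _ _; set b := bigop _ _ _; lra.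
Qed.

(** Write a = M - (M - a): both series have nonnegative terms, and M - a <= 2 M. *)
Lemma cvg_dominated_real (a : nat -> R) M :
  (forall n, (0 < n)%N -> `|a n| <= M n) -> bounded_sums M ->
  cvgn (fun N => \sum_(1 <= n < N.+1) a n).
Proof.
move=> aM [K bK].
have nneg_cvg (b : nat -> R) (L : R) : (forall n, (0 < n)%N -> 0 <= b n) ->
    (forall N, \sum_(1 <= n < N.+1) b n <= L) ->
    cvgn (fun N => \sum_(1 <= n < N.+1) b n).
  move=> b0 bL; apply: nondecreasing_is_cvgn; last by exists L => _ [N _ <-].
  apply/nondecreasing_seqP => N; rewrite [leRHS]big_nat_recr //= lerDl.
  exact: b0.
have -> : (fun N => \sum_(1 <= n < N.+1) a n) =
  (fun N => \sum_(1 <= n < N.+1) M n) \- (fun N => \sum_(1 <= n < N.+1) (M n - a n)).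
  by apply/funext => N /=; rewrite -sumrB; apply: eq_bigr => n _; rewrite subKr.
apply: is_cvgB; first by apply: nneg_cvg bK => n /aM; apply: le_trans.
apply: (nneg_cvg _ (K *+ 2)) => [n /aM|N].
  by rewrite subr_ge0 => /(le_trans (ler_norm _)).
rewrite mulr2n; apply: le_trans (lerD (bK N) (bK N)).
rewrite -big_split /= big_nat [leRHS]big_nat; apply: ler_sum => n /andP[/aM h _].
by rewrite lerD2l; apply: le_trans h; rewrite -normrN ler_norm.
Qed.

Lemma series_to_sum P u s : series_to P u s -> series_sum P u = s.
Proof. by move=> us; apply: (@cvg_lim R[i]^o) => //; apply: norm_hausdorff. Qed.



Lemma partial_sum_mkcond P u :
  partial_sum P u = partial_sum predT (fun n => if P n then u n else 0).
Proof. by apply/funext => N; rewrite /partial_sum big_mkcond. Qed.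

Lemma series_cvg_dominated P u M :
  (forall n, (0 < n)%N -> P n -> normc (u n) <= M n) ->
  (forall n, (0 < n)%N -> 0 <= M n) ->
  bounded_sums M -> series_cvg P u.
Proof.
move=> uM M0 bM; rewrite /series_cvg partial_sum_mkcond.
set w := fun n => _.
have wM n : (0 < n)%N -> normc (w n) <= M n.
  by rewrite /w; case: ifP => [|_] *; [exact: uM|rewrite Normc.normc0 M0].
have cR := cvg_dominated_real (Re \o w) M
  (fun n n0 => le_trans (Re_le_normc _) (wM n n0)) bM.
have cI := cvg_dominated_real (Im \o w) M
  (fun n n0 => le_trans (Im_le_normc _) (wM n n0)) bM.
apply/cvg_ex; exists (limn (fun N => \sum_(1 <= n < N.+1) Re (w n)) +i*
                      limn (fun N => \sum_(1 <= n < N.+1) Im (w n))).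
apply/cvg_normcP => e e0; have e2 : 0 < e / 2 by rewrite divr_gt0.
move/cvgrPdist_le: cR => /(_ _ e2) cR; move/cvgrPdist_le: cI => /(_ _ e2) cI.
near=> N.
have -> : partial_sum predT w N =
    (\sum_(1 <= n < N.+1) Re (w n)) +i* (\sum_(1 <= n < N.+1) Im (w n)).
  rewrite /partial_sum; apply/eqP; rewrite eq_complex /=.
  by rewrite (raddf_sum (Re : Rcomplex R -> R)) (raddf_sum (Im : Rcomplex R -> R)) !eqxx.
apply: le_trans (normc_le _ _) _; rewrite [leRHS]splitr; apply: lerD.
  by near: N; exact: cR.
by near: N; exact: cI.
Unshelve. all: by end_near. Qed.

Lemma normc_series_le P u s M (K : R) :
  (forall n, (0 < n)%N -> P n -> normc (u n) <= M n) ->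
  (forall n, (0 < n)%N -> 0 <= M n) ->
  (forall N, \sum_(1 <= n < N.+1) M n <= K) ->
  series_to P u s -> normc s <= K.
Proof.
move=> uM M0 bK us; apply/ler_addgt0Pr => e e0.
move/cvg_normcP : us => /(_ _ e0) [N _ /(_ N (leqnn N)) /= le_e].
rewrite -[s](subrK (partial_sum P u N)) (le_trans (le_normcD _ _)) // addrC lerD //.
apply: le_trans (bK N); apply: le_trans (normc_sum _ _ _ _) _.
rewrite big_mkcond big_nat [leRHS]big_nat; apply: ler_sum => n /andP[n0 _].
by case: ifP => ?; [apply: uM|apply: M0].
Qed.

Lemma cvgC_sum (T I : Type) (Fil : set_system T) (FF : Filter Fil) (r : seq I)
    (Q : pred I) (f : T -> I -> R[i]) (l : I -> R[i]) :
  (forall i, Q i -> (fun x => f x i : R[i]^o) @ Fil --> (l i : R[i]^o)) ->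
  (fun x => \sum_(i <- r | Q i) f x i : R[i]^o) @ Fil -->
    (\sum_(i <- r | Q i) l i : R[i]^o).
Proof.
move=> fl; elim: r => [|i r IH].
  rewrite big_nil; under eq_fun do rewrite big_nil; exact: cvg_cst.
rewrite big_cons; under eq_fun do rewrite big_cons.
case: ifP => [Qi|_]; last exact: IH.
by apply: (@cvgD _ R[i]^o _ _ _ (fun x => f x i)
  (fun x => \sum_(j <- r | Q j) f x j)); [exact: fl|exact: IH].
Qed.

Lemma cvgC_mull (T : Type) (Fil : set_system T) (FF : Filter Fil)
    (k : R[i]) (f : T -> R[i]) (l : R[i]) :
  (fun x => f x : R[i]^o) @ Fil --> (l : R[i]^o) ->
  (fun x => k * f x : R[i]^o) @ Fil --> (k * l : R[i]^o).
Proof. by move=> fl; exact: (cvgZl_tmp (k := k) fl). Qed.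

Lemma series_to_mull P u s (k : R[i]) : series_to P u s ->
  series_to P (fun n => k * u n) (k * s).
Proof.
move=> us; rewrite /series_to.
have -> : partial_sum P (fun n => k * u n) = (fun N => k * partial_sum P u N).
  by apply/funext => N; rewrite /partial_sum mulr_sumr.
exact: cvgC_mull.
Qed.

(** The majorant makes the tails small uniformly along the filter, and the remaining finite sum
    converges termwise. The filter is arbitrary because both a real x and integer cut-offs tend to
    infinity below. *)
Lemma tannery (T : Type) (Fil : set_system T) (FF : ProperFilter Fil)
    (f : T -> nat -> R[i]) (v : nat -> R[i]) (s : T -> R[i]) M :
  bounded_sums M ->
  (\forall x \near Fil, forall k, (0 < k)%N -> normc (f x k) <= M k) ->
  (forall k, (0 < k)%N -> (fun x => f x k : R[i]^o) @ Fil --> (v k : R[i]^o)) ->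
  (\forall x \near Fil, series_to predT (f x) (s x)) ->
  exists S : R[i], series_to predT v S /\
    (fun x => s x : R[i]^o) @ Fil --> (S : R[i]^o).
Proof.
move=> bM fM fv fs.
have M0 k : (0 < k)%N -> 0 <= M k.
  move=> k0; have [x /(_ k k0)] := filter_ex fM.
  exact: le_trans (normc_ge0 _).
(* The limits inherit the majorant, because the filter is proper and some x is close to the
   limit. *)
have vM k : (0 < k)%N -> normc (v k) <= M k.
  move=> k0; apply/ler_addgt0Pr => e e0.
  have /cvg_normcP/(_ _ e0) vk := fv k k0.
  have [x [fx vx]] := filter_ex (filterI fM vk).
  rewrite -[v k](subrK (f x k)) (le_trans (le_normcD _ _)) // addrC lerD //.
  exact: fx.
have cv : series_cvg predT v by apply: series_cvg_dominated M0 bM => k k0 _; exact: vM.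
exists (series_sum predT v); split; first exact: cv.
have tail (w : nat -> R[i]) (t : R[i]) (N0 : nat) (e : R) :
    (forall k, (0 < k)%N -> normc (w k) <= M k) ->
    (forall N, \sum_(N0.+1 <= n < N.+1) M n <= e) -> series_to predT w t ->
    normc (t - partial_sum predT w N0) <= e.
  move=> wM tM wt; apply/ler_addgt0Pr => d d0.
  move/cvg_normcP: wt => /(_ _ d0) [N1 _ HN1].
  pose N := maxn N1 N0; have /= := HN1 N (leq_maxl _ _).
  move=> le_d; rewrite -[t](subrK (partial_sum predT w N)) -addrA addrC.
  rewrite (le_trans (le_normcD _ _)) // lerD //.
  have -> : partial_sum predT w N - partial_sum predT w N0 =
      \sum_(N0.+1 <= n < N.+1) w n.
    rewrite /partial_sum (@big_cat_nat _ _ _ N0.+1) //= ?ltnS ?leq_maxr //.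
    by ring.
  apply: le_trans (normc_sum _ _ _ _) _; apply: le_trans (tM N).
  rewrite big_nat [leRHS]big_nat; apply: ler_sum => n /andP[n0 _].
  by apply: wM; apply: leq_ltn_trans n0.
apply/cvg_normcP => e e0; have e3 : 0 < e / 3 by rewrite divr_gt0.
have [N0 tN0] := bounded_sums_tail M M0 bM _ e3.
have /cvg_normcP/(_ _ e3) fin : (fun x => partial_sum predT (f x) N0) @ Fil -->
    partial_sum predT v N0.
  rewrite /partial_sum big_nat; under eq_fun do rewrite big_nat.
  by apply: cvgC_sum => n /andP[n0 _]; exact: fv.
near=> x.
(* Tail of the limit series, difference of the two finite heads, tail of the series at x: e/3 for
   each. *)
have -> : series_sum predT v - s x =
  (series_sum predT v - partial_sum predT v N0) +
  ((partial_sum predT v N0 - partial_sum predT (f x) N0) +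
   - (s x - partial_sum predT (f x) N0)) by ring.
have -> : e = e / 3 + (e / 3 + e / 3) by field.
apply: le_trans (le_normcD _ _) _; apply: lerD; first exact: tail tN0 _.
apply: le_trans (le_normcD _ _) _; apply: lerD; first by near: x; exact: fin.
rewrite normcN; apply: tail tN0 _; first by near: x; exact: fM.
by near: x; exact: fs.
Unshelve. all: by end_near. Qed.

Lemma series_to_finite u (N : nat) : (forall n, (N < n)%N -> u n = 0) ->
  series_to predT u (\sum_(1 <= n < N.+1) u n).
Proof.
move=> u0; apply: cvg_near_cst; exists N => //= n /= leN.
rewrite /partial_sum (@big_cat_nat _ _ _ N.+1) //= [X in _ + X]big_nat.
by rewrite [X in _ + X]big1 ?addr0 // => k /andP[kN _]; exact: u0.
Qed.

End ComplexSeries.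

(** * Smooth numbers and mean values *)

Lemma smooth0 (n : nat) : smooth 0 n = (n == 1%N).
Proof.
rewrite /smooth; case: n => [|[|n]] //=.
apply/allP => /(_ (pdiv n.+2)) h.
have : (pdiv n.+2 <= 0)%N.
  by apply: h; rewrite mem_primes pdiv_prime // pdiv_dvd.
by rewrite leqNgt pdiv_gt0.
Qed.

(** Raising the bound by one admits at most one new prime; this drives the inductions on V. *)
Lemma smoothS (V n : nat) :
  smooth V n = smooth V.+1 n && ~~ (prime V.+1 && (V.+1 %| n)%N).
Proof.
rewrite /smooth; case: posnP => //= n_gt0; apply/idP/andP.
  move=> /allP sn; split; first by apply/allP => p /sn /leqW.
  apply/negP => /andP[p_pr pn]; have := sn V.+1.
  by rewrite mem_primes p_pr n_gt0 pn ltnn => /(_ isT).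
case=> /allP sn np; apply/allP => p p_n; have := sn p p_n.
rewrite leq_eqVlt ltnS => /orP[/eqP pV|//].
by move: p_n; rewrite mem_primes n_gt0 pV /= (negbTE np).
Qed.

Lemma smooth_prime (V : nat) : prime V -> smooth V V.
Proof. by move=> Vp; rewrite /smooth prime_gt0 // primes_prime //= leqnn. Qed.

Lemma omega_smooth (V n : nat) : smooth V n -> (omega n <= V)%N.
Proof.
case/andP=> n_gt0 /allP sn; rewrite -[leqRHS](size_iota 1).
apply: uniq_leq_size (primes_uniq n) _ => p pn.
rewrite mem_iota add1n ltnS (sn p pn) andbT.
by move: pn; rewrite mem_primes => /andP[/prime_gt0].
Qed.

(** Split by divisibility by p = V+1; a smooth multiple is p m with m still allowed to contain p.
    This is the finite form of the Euler factor recursion. *)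
Lemma sum_smooth_prime (M : nmodType) (h : nat -> M) (V N : nat) :
  prime V.+1 ->
  \sum_(1 <= n < N.+1 | smooth V.+1 n) h n =
  \sum_(1 <= n < N.+1 | smooth V n) h n +
  \sum_(1 <= m < (N %/ V.+1).+1 | smooth V.+1 m) h (V.+1 * m)%N.
Proof.
move=> p_pr; rewrite (bigID (fun n => (V.+1 %| n)%N)) /= addrC; congr (_ + _).
  by apply: eq_bigl => n; rewrite [in RHS]smoothS p_pr.
under eq_bigl do rewrite andbC.
rewrite sum_multiples_cond //; apply: eq_bigl => m.
by rewrite smooth_mul smooth_prime.
Qed.

Section Main.
Variable R : realType.
Implicit Types (F G H : nat -> R[i]) (V l d n N : nat).
Local Notation normc := (@Normc.normc R).
Local Notation c := (ramanujan_sum R).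

(* The majorant of all the series below; extended by zero it is completely
   multiplicative. *)
Definition smooth_rsqrt V n : R :=
  if smooth V n then (Num.sqrt n%:R)^-1 else 0.

Lemma smooth_rsqrt_ge0 V n : 0 <= smooth_rsqrt V n.
Proof. by rewrite /smooth_rsqrt; case: ifP => // _; rewrite invr_ge0 sqrtr_ge0. Qed.

Lemma smooth_rsqrtM V m n :
  smooth_rsqrt V (m * n) = smooth_rsqrt V m * smooth_rsqrt V n.
Proof.
rewrite /smooth_rsqrt smooth_mul; case: ifP => [/andP[-> ->]|].
  by rewrite natrM sqrtrM ?ler0n // invfM.
by do 2!case: ifP => //; rewrite ?(mulr0, mul0r).
Qed.

Lemma inv_le_rsqrt n : (0 < n)%N -> n%:R^-1 <= (Num.sqrt n%:R)^-1 :> R.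
Proof.
move=> n0; have n1 : 1 <= n%:R :> R by rewrite ler1n.
have s1 : 1 <= Num.sqrt n%:R :> R by rewrite -[leLHS]sqrtr1 ler_sqrt // (lt_le_trans ltr01).
rewrite lef_pV2 ?posrE ?ltr0n //; last exact: lt_le_trans s1.
by rewrite -[leRHS]sqr_sqrtr ?ler0n // expr2 ler_peMl // (le_trans ler01).
Qed.

Lemma sqrt_div n : Num.sqrt n%:R / n%:R = (Num.sqrt n%:R)^-1 :> R.
Proof.
have [->|n0] := posnP n; first by rewrite sqrtr0 mul0r invr0.
have s0 : Num.sqrt n%:R != 0 :> R by rewrite gt_eqF // sqrtr_gt0 ltr0n.
by rewrite -[X in _ / X]sqr_sqrtr ?ler0n // expr2 invfM mulrA divff // mul1r.
Qed.

(** Induction on V. For p = V+1 prime and r = p^(-1/2), the new sum T(N) satisfies T(N) <= K + r T(N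
    / p) <= K + r T(N), hence T(N) <= K / (1 - r). *)
Lemma bounded_sums_smooth_rsqrt V : bounded_sums R (smooth_rsqrt V).
Proof.
rewrite /bounded_sums /smooth_rsqrt.
elim: V => [|V [K bK]].
  exists 1 => N; rewrite -big_mkcond; under eq_bigl do rewrite smooth0.
  case: N => [|N]; first by rewrite big_geq // ler01.
  rewrite big_ltn_cond //= sqrtr1 invr1 big_nat_cond big1 ?addr0 // => i.
  by case/andP=> /andP[i1 _] /eqP i1'; rewrite i1' in i1.
have [p_pr|np] := boolP (prime V.+1); last first.
  exists K => N; apply: le_trans (bK N); apply: ler_sum => n _.
  by rewrite [smooth V n]smoothS (negbTE np) andbT.
pose r : R := (Num.sqrt V.+1%:R)^-1.
have s1 : 1 < Num.sqrt V.+1%:R :> R.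
  by rewrite -[ltLHS]sqrtr1 ltr_sqrt ?ltr0n // ltr1n prime_gt1.
have r1 : 0 < 1 - r by rewrite subr_gt0 invf_lt1 // (lt_trans ltr01).
have r0 : 0 <= r by rewrite invr_ge0 sqrtr_ge0.
exists (K / (1 - r)) => N; rewrite ler_pdivlMr // mulrBr mulr1 lerBlDr.
rewrite -big_mkcond {1}sum_smooth_prime //; apply: lerD.
  by rewrite big_mkcond.
under [leLHS]eq_bigr do rewrite natrM sqrtrM ?ler0n // invfM.
rewrite -mulr_sumr mulrC; apply: ler_wpM2r => //.
have le_NV : ((N %/ V.+1).+1 <= N.+1)%N by rewrite ltnS leq_div.
rewrite [leRHS](@big_cat_nat _ _ _ (N %/ V.+1).+1) //= lerDl.
by apply: sumr_ge0 => n _; rewrite invr_ge0 sqrtr_ge0.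
Qed.

Lemma cvg_divn (d : nat) : (0 < d)%N -> (fun N => (N %/ d)%N) @ \oo --> \oo.
Proof.
move=> d0 A [n _ nA]; exists (n * d)%N => //= N /= le_N.
by apply: nA; rewrite /= leq_divRL.
Qed.

(** Induction on V: a new prime p gives Z = Z' + Z / p, where Z' is the previous sum. Convergence is
    established first, so that this equation may be solved for Z. *)
Lemma series_inv_smooth V :
  series_to (smooth V) (fun m => m%:R^-1) (euler_factor R V)^-1.
Proof.
have cvgZ W : series_cvg (smooth W) (fun m => m%:R^-1 : R[i]).
  apply: (@series_cvg_dominated _ _ _ (smooth_rsqrt W)) (bounded_sums_smooth_rsqrt W).
    move=> n n0 sn; rewrite Normc.normcV normc_nat /smooth_rsqrt sn.
    exact: inv_le_rsqrt.
  by move=> n _; apply: smooth_rsqrt_ge0.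
elim: V => [|V IH].
  rewrite /euler_factor big_geq // invr1; apply: cvg_near_cst.
  exists 1%N => //= -[//|N] _; rewrite /partial_sum.
  under eq_bigl do rewrite smooth0.
  rewrite big_ltn_cond //= invr1 big_nat_cond big1 ?addr0 // => i.
  by case/andP=> /andP[i1 _] /eqP i1'; rewrite i1' in i1.
have eS : euler_factor R V.+1 =
    euler_factor R V * (if prime V.+1 then 1 - V.+1%:R^-1 else 1).
  by rewrite /euler_factor big_mkcond big_nat_recr //= -big_mkcond.
rewrite eS; case: ifP => [p_pr|np]; last first.
  rewrite mulr1 /series_to; under eq_fun do rewrite /partial_sum.
  apply: cvg_trans IH; apply: near_eq_cvg; apply: nearW => N.
  by apply: eq_bigl => n; rewrite smoothS np andbT.
have [Z Zlim] : exists Z, series_to (smooth V.+1) (fun m => m%:R^-1 : R[i]) Z.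
  by exists (series_sum (smooth V.+1) (fun m => m%:R^-1)); apply: cvgZ.
suff <- : Z = (euler_factor R V * (1 - V.+1%:R^-1))^-1 by [].
have ZE : Z = (euler_factor R V)^-1 + V.+1%:R^-1 * Z.
  rewrite -[LHS](@series_to_sum _ _ _ _ Zlim); apply: series_to_sum.
  rewrite /series_to.
  (* The second summand is cut at N / p, which also tends to infinity, so its limit is again Z /
     p. *)
  have -> : partial_sum (smooth V.+1) (fun m => m%:R^-1 : R[i]) =
    (fun N => partial_sum (smooth V) (fun m => m%:R^-1) N +
     V.+1%:R^-1 * partial_sum (smooth V.+1) (fun m => m%:R^-1) (N %/ V.+1)).
    apply/funext => N; rewrite /partial_sum sum_smooth_prime // mulr_sumr.
    by congr (_ + _); apply: eq_bigr => m _; rewrite natrM invfM.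
  apply: (cvgD IH); apply: cvgC_mull.
  exact: (cvg_comp _ _ (cvg_divn V.+1 isT) Zlim).
have p1 : 1 - V.+1%:R^-1 != 0 :> R[i].
  rewrite subr_eq0 eq_sym invr_eq1 pnatr_eq1.
  by apply: contraTneq p_pr => ->.
rewrite invfM -[Z](mulfK p1) mulrBr mulr1.
by rewrite {1}ZE mulrC [Z * _]mulrC addrK mulrC.
Qed.

Lemma euler_factor_neq0 V : euler_factor R V != 0.
Proof.
rewrite /euler_factor prodf_seq_neq0; apply/allP => p _; apply/implyP => p_pr.
rewrite subr_eq0 eq_sym invr_eq1 pnatr_eq1.
by apply: contraTneq p_pr => ->.
Qed.

(** For t | d each |F(t)| is at most C sqrt d, and the sum of |mu(d/t)| is 2^omega(d) <= 2^V by
    smoothness. *)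
Lemma normc_eratosthenes F V (C : R) d : 0 <= C ->
  (forall n, (0 < n)%N -> normc (F n) <= C * Num.sqrt n%:R) ->
  smooth V d -> normc (eratosthenes F d) <= C * 2 ^+ V * Num.sqrt d%:R.
Proof.
move=> C0 FC sd; have d0 : (0 < d)%N by case/andP: sd.
apply: le_trans (normc_sum _ _ _ _ _) _.
apply: (@le_trans _ _ (\sum_(t <- divisors d)
   C * Num.sqrt d%:R * `|mobius (d %/ t)|%:~R)).
  rewrite big_seq [leRHS]big_seq; apply: ler_sum => t.
  rewrite -dvdn_divisors // => td; rewrite Normc.normcM normc_int.
  apply: ler_wpM2r; first by rewrite ler0z.
  apply: le_trans (FC t (dvdn_gt0 d0 td)) _; apply: ler_wpM2l => //.
  by rewrite ler_wsqrtr // ler_nat dvdn_leq.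
rewrite (sum_divisors_compl _ (fun e => C * Num.sqrt d%:R * `|mobius e|%:~R)) //.
rewrite -mulr_sumr -(rmorph_sum (intmul 1)) /= sum_norm_mobius // rmorphXn /=.
rewrite -mulrA [leRHS]mulrAC -mulrA; apply: ler_wpM2l => //; rewrite ler_wpM2l ?sqrtr_ge0 //.
by rewrite ler_weXn2l ?ler1n // omega_smooth.
Qed.

(** * Bounds and mean values of Ramanujan sums *)

Lemma normc_ramanujan_le l n : (0 < l)%N ->
  normc (c l n) <= \sum_(g <- divisors l | (g %| n)%N) `|mobius (l %/ g)|%:~R * g%:R.
Proof.
move=> l0; rewrite ramanujan_sumE //; apply: le_trans (normc_sum _ _ _ _ _) _.
rewrite [leRHS]big_mkcond; apply: ler_sum => g _.
rewrite Normc.normcM normc_int normc_nat mulrC.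
by case: (g %| n)%N; rewrite ?muln1 // muln0 mulr0.
Qed.

Lemma intr_norm_mobius_le1 n : `|mobius n|%:~R <= 1 :> R.
Proof. by rewrite -[leRHS](mulr1z 1) ler_int norm_mobius_le1. Qed.

Lemma normc_ramanujan_bound_l l n : (0 < l)%N ->
  normc (c l n) <= \sum_(g <- divisors l) g%:R.
Proof.
move=> l0; apply: le_trans (normc_ramanujan_le _ n l0) _.
rewrite big_mkcond; apply: ler_sum => g _; case: ifP => // _.
by rewrite ler_piMl // intr_norm_mobius_le1.
Qed.

(** Only common divisors of l and n contribute, which makes the bound uniform in l, while
    [normc_ramanujan_bound_l] is uniform in n. *)
Lemma normc_ramanujan_bound_r l n : (0 < l)%N -> (0 < n)%N ->
  normc (c l n) <= \sum_(1 <= g < n.+1) g%:R.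
Proof.
move=> l0 n0; apply: le_trans (normc_ramanujan_le _ n l0) _.
apply: (@le_trans _ _ (\sum_(g <- divisors l | (g %| n)%N) g%:R)).
  by apply: ler_sum => g _; rewrite ler_piMl // intr_norm_mobius_le1.
(* The cut-off l + n is a common range for the divisors of l and of n. *)
rewrite big_mkcond (@sum_divisors _ _ _ (l + n)) ?l0 ?leq_addr //.
apply: (@le_trans _ _ (\sum_(1 <= g < (l + n).+1 | (g %| n)%N) g%:R)).
  rewrite big_mkcond [leRHS]big_mkcond; apply: ler_sum => g _.
  by case: ifP => // _; case: ifP.
rewrite -sum_divisors ?n0 ?leq_addl // (@sum_divisors _ _ _ n) ?n0 ?leqnn //.
by rewrite big_mkcond; apply: ler_sum => g _; case: ifP.
Qed.

(** At most N / g multiples of g lie below N, which cancels the weight g and leaves the sum of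
    |mu(l/g)|; hence the factor 2^omega(l). *)
Lemma sum_normc_ramanujan l N : (0 < l)%N ->
  \sum_(1 <= n < N.+1) normc (c l n) <= N%:R * 2 ^+ omega l.
Proof.
move=> l0.
apply: (@le_trans _ _ (\sum_(1 <= n < N.+1) \sum_(g <- divisors l | (g %| n)%N)
   `|mobius (l %/ g)|%:~R * g%:R)).
  by apply: ler_sum => n _; apply: normc_ramanujan_le.
rewrite (exchange_big_dep xpredT) //=.
apply: (@le_trans _ _ (\sum_(g <- divisors l) N%:R * `|mobius (l %/ g)|%:~R)).
  rewrite big_seq [leRHS]big_seq; apply: ler_sum => g.
  rewrite -dvdn_divisors // => gl; rewrite sum_multiples ?(dvdn_gt0 l0) //.
  rewrite sumr_const_nat subn1 /= -[_ *+ (N %/ g)]mulr_natr -mulrA [leRHS]mulrC.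
  apply: ler_wpM2l; first by rewrite ler0z.
  by rewrite -natrM ler_nat mulnC leq_trunc_div.
rewrite (sum_divisors_compl _ (fun e => N%:R * `|mobius e|%:~R)) //.
by rewrite -mulr_sumr -(rmorph_sum (intmul 1)) /= sum_norm_mobius // rmorphXn.
Qed.

Lemma cvg_mean_dvd (e : nat) : (0 < e)%N ->
  ((x^-1)%:C * \sum_(1 <= n < (Num.truncn x).+1) (e %| n)%:R : R[i]^o)
    @[x --> (+oo : set_system R)] --> (e%:R^-1 : R[i]^o).
Proof.
move=> e0; have eR : 0 < e%:R :> R by rewrite ltr0n.
apply/cvg_normcP => eps eps0; near=> x.
have x0 : 0 < x by near: x; exact: nbhs_pinfty_gt.
set N := Num.truncn x; set q := (N %/ e)%N.
have -> : \sum_(1 <= n < N.+1) (e %| n)%:R = q%:R :> R[i].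
  transitivity (\sum_(1 <= n < N.+1 | (e %| n)%N) 1 : R[i]).
    by rewrite [RHS]big_mkcond; apply: eq_bigr => n _; case: (e %| n)%N.
  by rewrite sum_multiples // sumr_const_nat subn1.
have -> : e%:R^-1 - (x^-1)%:C * q%:R = (e%:R^-1 - x^-1 * q%:R)%:C.
  by rewrite rmorphB rmorphM !fmorphV /= !rmorph_nat.
rewrite normc_real.
have Nx : N%:R <= x < N.+1%:R by apply: truncn_itv; exact: ltW.
have qN : q%:R * e%:R <= N%:R :> R by rewrite -natrM ler_nat leq_trunc_div.
have Nq : N.+1%:R <= q%:R * e%:R + e%:R :> R.
  rewrite -natrM -natrD ler_nat {1}(divn_eq N e) -addnS leq_add2l.
  by rewrite ltn_mod.
(* The numerator lies in [0, e], so the error is at most 1 / x. *)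
have -> : e%:R^-1 - x^-1 * q%:R = (x - q%:R * e%:R) / (e%:R * x).
  by field; rewrite !gt_eqF.
rewrite ger0_norm; last first.
  rewrite divr_ge0 // ?mulr_ge0 ?(ltW eR) ?(ltW x0) //; lra.
rewrite ler_pdivrMr ?mulr_gt0 //.
have x1 : 1 <= eps * x.
  by rewrite mulrC -ler_pdivrMr //; near: x; apply: nbhs_pinfty_ge; rewrite num_real.
rewrite mulrCA; apply: (@le_trans _ _ e%:R); first by lra.
by rewrite ler_peMr // ltW.
Unshelve. all: by end_near. Qed.

Lemma eratosthenes_dvd (q l : nat) : (0 < l)%N ->
  eratosthenes (fun g => (q %| g)%:R : R[i]) l = (l == q)%:R.
Proof.
move=> l0; apply: (@eratosthenes_sum _ _ (fun l => (l == q)%:R)) => // m ml.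
have m0 := dvdn_gt0 l0 ml.
case: (boolP (q %| m)%N) => qm.
  rewrite (bigD1_seq q) ?divisors_uniq -?dvdn_divisors //= eqxx big1 ?addr0 //.
  by move=> i /negbTE ->.
rewrite big_seq big1 // => d; rewrite -dvdn_divisors // => dm.
by case: eqP dm qm => // -> ->.
Qed.

(** Expand both sums over g | l and h | q. The joint condition lcm(g, h) | n has mean 1 / lcm(g, h),
    and g h / lcm(g, h) = gcd(g, h); then [eratosthenes_gcd] sums over h and [eratosthenes_dvd] over
    g. *)
Lemma cvg_mean_ramanujan (l q : nat) : (0 < l)%N -> (0 < q)%N ->
  ((x^-1)%:C * \sum_(1 <= n < (Num.truncn x).+1) c l n * c q n : R[i]^o)
    @[x --> (+oo : set_system R)] --> ((totient q * (l == q))%:R : R[i]^o).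
Proof.
move=> l0 q0.
pose w g h : R[i] := g%:R * (mobius (l %/ g))%:~R * (h%:R * (mobius (q %/ h))%:~R).
have -> : (fun x : R => (x^-1)%:C *
      \sum_(1 <= n < (Num.truncn x).+1) c l n * c q n : R[i]^o) =
    (fun x => \sum_(g <- divisors l) \sum_(h <- divisors q)
      w g h * ((x^-1)%:C * \sum_(1 <= n < (Num.truncn x).+1) (lcmn g h %| n)%:R)).
  apply/funext => x.
  under [RHS]eq_bigr do under eq_bigr do rewrite mulrCA.
  under [RHS]eq_bigr do rewrite -mulr_sumr.
  rewrite -mulr_sumr; congr (_ * _).
  under [RHS]eq_bigr do under eq_bigr do rewrite mulr_sumr.
  under [RHS]eq_bigr do rewrite exchange_big /=.
  rewrite [RHS]exchange_big /=; apply: eq_bigr => n _.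
  rewrite !ramanujan_sumE // /eratosthenes big_distrlr /=.
  apply: eq_bigr => g _; apply: eq_bigr => h _; rewrite /w dvdn_lcm.
  by case: (g %| n)%N; case: (h %| n)%N; rewrite /= ?muln1 ?muln0 ?mulr0 ?mul0r ?mulr1 // mulr0.
(* The filters repeat the ranges so that [cvgC_sum] hands over the divisibilities, hence
   positivity. *)
have lim : ((totient q * (l == q))%:R : R[i]) =
    \sum_(g <- divisors l | g \in divisors l) \sum_(h <- divisors q | h \in divisors q)
      w g h * (lcmn g h)%:R^-1.
  transitivity (\sum_(g <- divisors l | g \in divisors l)
      (mobius (l %/ g))%:~R * (totient q * (q %| g))%:R : R[i]).
    rewrite natrM -eratosthenes_dvd // mulr_sumr -big_seq; apply: eq_bigr => g _.
    by rewrite natrM; ring.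
  apply: eq_bigr => g; rewrite -dvdn_divisors // => gl.
  have g0 := dvdn_gt0 l0 gl.
  rewrite -eratosthenes_gcd // mulr_sumr big_seq; apply: eq_bigr => h.
  rewrite -dvdn_divisors // => hq; have h0 := dvdn_gt0 q0 hq.
  have lc0 : (lcmn g h)%:R != 0 :> R[i] by rewrite pnatr_eq0 -lt0n lcmn_gt0 g0.
  have := muln_lcm_gcd g h; rewrite gcdnC => /(congr1 (fun k => k%:R : R[i])).
  rewrite !natrM => e; apply: (mulIf lc0).
  rewrite divfK // /w; set m := _%:~R; set m' := _%:~R.
  transitivity (m * m' * ((lcmn g h)%:R * (gcdn h g)%:R)); first by ring.
  by rewrite e; ring.
rewrite lim.
under eq_fun do (rewrite big_seq; under eq_bigr do rewrite big_seq).
apply: cvgC_sum => g; rewrite -dvdn_divisors // => gl.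
apply: cvgC_sum => h; rewrite -dvdn_divisors // => hq.
apply: cvgC_mull; apply: cvg_mean_dvd.
by rewrite lcmn_gt0 (dvdn_gt0 l0 gl) (dvdn_gt0 q0 hq).
Qed.

End Main.

(** * Coefficients of the smooth part *)

Section Expansion.
Variable R : realType.
Implicit Types (F G H : nat -> R[i]) (V l d n N : nat).
Local Notation normc := (@Normc.normc R).
Local Notation c := (ramanujan_sum R).

(** Tannery in l as x grows: |c_q| is at most the divisor sum [sq], and the mean of |c_l| is at most
    2^omega(l), whence the majorant. *)
Lemma carmichael_mean_expansion G H (q : nat) : (0 < q)%N ->
  (forall a, (0 < a)%N -> series_to predT (fun l => G l * c l a) (H a)) ->
  bounded_sums R (fun l => 2 ^+ omega l * normc (G l)) ->
  carmichael_mean q H x @[x --> +oo] --> ((totient q)%:R * G q : R[i]^o).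
Proof.
move=> q0 GH bG; pose sq : R := \sum_(g <- divisors q) g%:R.
have sq0 : 0 <= sq by apply: sumr_ge0.
pose f (x : R) l := G l * ((x^-1)%:C *
  \sum_(1 <= n < (Num.truncn x).+1) c l n * c q n).
pose v l := G l * (totient q * (l == q))%:R.
have [||||S [vS limS]] := @tannery R R (+oo : set_system R) _ f v
   (carmichael_mean q H) (fun l => sq * (2 ^+ omega l * normc (G l))).
- by apply: bounded_sums_le sq0 _ bG.
- near=> x => l l0; have x0 : 0 < x by near: x; exact: nbhs_pinfty_gt.
  rewrite /f !Normc.normcM normc_real gtr0_norm ?invr_gt0 //.
  rewrite [leRHS](_ : _ = normc (G l) * (2 ^+ omega l * sq)); last by ring.
  apply: ler_wpM2l; first exact: normc_ge0.
  rewrite mulrC ler_pdivrMr //.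
  apply: le_trans (normc_sum _ _ _ _ _) _.
  apply: (@le_trans _ _ (\sum_(1 <= n < (Num.truncn x).+1) normc (c l n) * sq)).
    apply: ler_sum => n _; rewrite Normc.normcM; apply: ler_wpM2l.
      exact: normc_ge0.
    exact: normc_ramanujan_bound_l.
  rewrite -mulr_suml mulrAC; apply: ler_wpM2r => //.
  apply: le_trans (sum_normc_ramanujan _ _ _ l0) _; rewrite mulrC.
  by apply: ler_wpM2l; rewrite ?exprn_ge0 // truncn_le ltW.
- by move=> l l0; apply: cvgC_mull; apply: cvg_mean_ramanujan.
(* For fixed x the mean is a finite sum over n, so the expansions of H(n) combine; the filter 0 < n
   is inserted because [GH] speaks of positive arguments. *)
- apply: nearW => x; rewrite /series_to /carmichael_mean.
  have -> : partial_sum predT (f x) = (fun N => (x^-1)%:C *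
      \sum_(1 <= n < (Num.truncn x).+1 | (0 < n)%N)
        c q n * partial_sum predT (fun l => G l * c l n) N).
    apply/funext => N; rewrite /partial_sum /f.
    under eq_bigr do rewrite mulrCA mulr_sumr.
    rewrite -mulr_sumr exchange_big /=; congr (_ * _).
    rewrite big_nat [RHS]big_nat_cond; apply: eq_big => n.
      by case: n => //= n; rewrite andbT.
    by move=> _; rewrite mulr_sumr; apply: eq_bigr => l _; ring.
  apply: cvgC_mull.
  have -> : \sum_(1 <= n < (Num.truncn x).+1) H n * c q n =
      \sum_(1 <= n < (Num.truncn x).+1 | (0 < n)%N) c q n * H n.
    rewrite big_nat [RHS]big_nat_cond; apply: eq_big => n.
      by case: n => //= n; rewrite andbT.
    by rewrite mulrC.
  by apply: cvgC_sum => n n0; apply: cvgC_mull; apply: GH.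
(* By orthogonality the limit series is supported at l = q. *)
suff <- : S = (totient q)%:R * G q by [].
rewrite -(series_to_sum _ _ _ _ vS); apply: series_to_sum.
have -> : (totient q)%:R * G q = \sum_(1 <= n < q.+1) v n.
  rewrite big_nat_recr //= big_nat big1 ?add0r => [|n /andP[_ nq]].
    by rewrite /v eqxx muln1 mulrC.
  by rewrite /v ltn_eqF // muln0 mulr0.
by apply: series_to_finite => n qn; rewrite /v gtn_eqF // muln0 mulr0.
Unshelve. all: by end_near. Qed.

Lemma Car_expansion G H (q : nat) : (0 < q)%N ->
  (forall a, (0 < a)%N -> series_to predT (fun l => G l * c l a) (H a)) ->
  bounded_sums R (fun l => 2 ^+ omega l * normc (G l)) ->
  Car_exists q H /\ Car q H = G q.
Proof.
move=> q0 GH bG; have lim := carmichael_mean_expansion _ _ _ q0 GH bG.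
split; first by apply/cvg_ex; exists ((totient q)%:R * G q).
rewrite /Car (@cvg_lim R[i]^o _ _ _ _ _ _ lim); last exact: norm_hausdorff.
by rewrite mulKf // pnatr_eq0 -lt0n totient_gt0.
Qed.

(** * Wintner coefficients over smooth multiples *)

Section SmoothCoefficients.
Variables (F : nat -> R[i]) (V : nat) (K S : R).
Hypothesis K0 : 0 <= K.
Hypothesis S0 : 0 <= S.
Hypothesis sumS : forall N, \sum_(1 <= n < N.+1) smooth_rsqrt R V n <= S.

(** Folding smoothness into the term leaves divisibility as the only index condition. *)
Let b d : R[i] := if smooth V d then eratosthenes F d / d%:R else 0.
Let P l d := smooth V d && (l %| d)%N.
Let B l := series_sum (P l) (fun d => eratosthenes F d / d%:R).

Hypothesis bK : forall d, normc (b d) <= K * smooth_rsqrt R V d.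

Lemma bounded_sums_rsqrt : bounded_sums R (smooth_rsqrt R V).
Proof. by exists S. Qed.

Lemma partial_sum_smooth_multiples l :
  partial_sum (P l) (fun d => eratosthenes F d / d%:R) =
  partial_sum (fun d => (l %| d)%N) b.
Proof.
apply/funext => N; rewrite /partial_sum /b [LHS]big_mkcond [RHS]big_mkcond.
by apply: eq_bigr => d _; rewrite /P; case: smooth; case: dvdn.
Qed.

(** For d = l m the majorant factors, so its value at l comes out. This gives the decay in l and the
    vanishing at non-smooth l. *)
Lemma sum_normc_multiples l N : (0 < l)%N ->
  \sum_(1 <= d < N.+1 | (l %| d)%N) normc (b d) <= K * S * smooth_rsqrt R V l.
Proof.
move=> l0; rewrite sum_multiples //.
apply: (@le_trans _ _ (\sum_(1 <= m < (N %/ l).+1)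
    K * smooth_rsqrt R V l * smooth_rsqrt R V m)).
  by apply: ler_sum => m _; rewrite -mulrA -smooth_rsqrtM; apply: bK.
rewrite -mulr_sumr [leRHS]mulrAC; apply: ler_wpM2l => //.
by rewrite mulr_ge0 // smooth_rsqrt_ge0.
Qed.

Lemma series_to_coef l : (0 < l)%N -> series_to (fun d => (l %| d)%N) b (B l).
Proof.
move=> l0; rewrite /B /series_sum partial_sum_smooth_multiples.
apply: (@series_cvg_dominated _ _ _ (fun d => K * smooth_rsqrt R V d)) => //.
- by move=> n _; rewrite mulr_ge0 // smooth_rsqrt_ge0.
- exact: bounded_sums_le K0 (fun n _ => lexx _) bounded_sums_rsqrt.
Qed.

Lemma normc_coef l : (0 < l)%N -> normc (B l) <= K * S * smooth_rsqrt R V l.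
Proof.
move=> l0; have := series_to_coef l l0.
apply: (@normc_series_le _ _ _ _ (fun d => if (l %| d)%N then normc (b d) else 0)).
- by move=> n _ ->.
- by move=> n _; case: ifP => // _; apply: normc_ge0.
- by move=> N; rewrite -big_mkcond; apply: sum_normc_multiples.
Qed.

Lemma coef_nsmooth l : (0 < l)%N -> ~~ smooth V l -> B l = 0.
Proof.
move=> l0 nsl; apply: Normc.eq0_normc; apply/eqP; rewrite eq_le normc_ge0 andbT.
by apply: le_trans (normc_coef l l0) _; rewrite /smooth_rsqrt (negbTE nsl) mulr0.
Qed.

(** On smooth l the weight 2^omega(l) is at most the constant 2^V. *)
Lemma bounded_sums_coef : bounded_sums R (fun l => 2 ^+ omega l * normc (B l)).
Proof.
apply: (@bounded_sums_le _ _ (smooth_rsqrt R V) (2 ^+ V * (K * S))).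
- by rewrite !mulr_ge0 // exprn_ge0.
- move=> l l0; have [sl|nsl] := boolP (smooth V l); last first.
    by rewrite coef_nsmooth // Normc.normc0 mulr0 !mulr_ge0 ?exprn_ge0 ?smooth_rsqrt_ge0.
  rewrite -mulrA; apply: ler_pM; rewrite ?exprn_ge0 ?normc_ge0 //; last exact: normc_coef.
  by rewrite ler_weXn2l ?ler1n // omega_smooth.
- exact: bounded_sums_rsqrt.
Qed.

(** The inner sum of c_l(a) over l | d is d if d | a and 0 otherwise. The identity is exact once D
    >= a, when all divisors of a are in range. *)
Lemma sum_smooth_part a D : (0 < a <= D)%N ->
  \sum_(1 <= l < D.+1) c l a * \sum_(1 <= d < D.+1 | (l %| d)%N) b d =
  smooth_part F V a.
Proof.
move=> aD; have /andP[a0 leD] := aD.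
transitivity (\sum_(1 <= d < D.+1) b d * \sum_(1 <= l < D.+1 | (l %| d)%N) c l a).
  under eq_bigr do rewrite mulr_sumr.
  rewrite (exchange_big_dep xpredT) //=; apply: eq_bigr => d _.
  by rewrite mulr_sumr; apply: eq_bigr => l _; rewrite mulrC.
rewrite /smooth_part [RHS]big_mkcond (sum_divisors _ _ a D) // [RHS]big_mkcond.
rewrite [LHS]big_nat [RHS]big_nat; apply: eq_bigr => d dD; have /andP[d0 _] := dD.
rewrite -sum_divisors // sum_ramanujan // /b.
case: smooth; case: dvdn; rewrite ?muln1 ?muln0 ?mulr0 ?mul0r //.
by rewrite divfK // pnatr_eq0 -lt0n.
Qed.

Lemma expansion_smooth_part a : (0 < a)%N ->
  series_to predT (fun l => B l * c l a) (smooth_part F V a).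
Proof.
move=> a0; pose ca : R := \sum_(1 <= g < a.+1) g%:R.
have ca0 : 0 <= ca by apply: sumr_ge0.
pose f D l := c l a * partial_sum (fun d => (l %| d)%N) b D.
have [||||T [vT limT]] := @tannery R nat \oo _ f (fun l => c l a * B l)
  (fun=> smooth_part F V a) (fun l => ca * (K * S) * smooth_rsqrt R V l).
- apply: (@bounded_sums_le _ _ (smooth_rsqrt R V) (ca * (K * S))) => //.
    by rewrite !mulr_ge0.
  exact: bounded_sums_rsqrt.
- apply: nearW => D l l0; rewrite /f Normc.normcM -mulrA.
  apply: ler_pM; rewrite ?normc_ge0 // ?normc_ramanujan_bound_r //.
  apply: le_trans (normc_sum _ _ _ _ _) _; exact: sum_normc_multiples.
- by move=> l l0; apply: cvgC_mull; apply: series_to_coef.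
(* No d <= D is a multiple of an l > D, so at cut-off D the series in l is finite. *)
- exists a => //= D /= aD; rewrite -(sum_smooth_part a D) ?a0 //.
  apply: series_to_finite => l lD; rewrite /f /partial_sum.
  rewrite big_nat_cond big1 ?mulr0 // => d /andP[/andP[d0 dD]] /(dvdn_leq d0).
  by rewrite leqNgt (leq_trans dD).
have -> : smooth_part F V a = T.
  rewrite -(@cvg_lim R[i]^o _ _ _ _ _ _ limT); last exact: norm_hausdorff.
  by rewrite lim_cst //; exact: norm_hausdorff.
suff -> : (fun l => B l * c l a) = (fun l => c l a * B l) by [].
by apply/funext => l; rewrite mulrC.
Qed.

Lemma dvdn_mul_gcd (g d m : nat) : (0 < g)%N ->
  (g %| d * m)%N = (g %/ gcdn g d %| m)%N.
Proof.
move=> g0; have h0 : (0 < gcdn g d)%N by rewrite gcdn_gt0 g0.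
by rewrite mulnC dvdn_divLR ?dvdn_gcdl // muln_gcdr dvdn_gcd (dvdn_mull m (dvdnn g)) //=.
Qed.

(** In c_l(d m), g | d m means that e = g / gcd(g, d) divides m. Writing m = e m' leaves gcd(g, d)
    times the reciprocal sum cut at N / e, and [eratosthenes_gcd] evaluates the sum over g. *)
Lemma cvg_smooth_ramanujan l d : smooth V l -> (0 < d)%N ->
  series_to (smooth V) (fun m => c l (d * m) / m%:R)
    ((euler_factor R V)^-1 * (totient l * (l %| d))%:R).
Proof.
move=> sl d0; have l0 : (0 < l)%N by case/andP: sl.
pose z : nat -> R[i]^o := partial_sum (smooth V) (fun m => m%:R^-1).
rewrite /series_to.
have -> : partial_sum (smooth V) (fun m => c l (d * m) / m%:R) = (fun N =>
   \sum_(g <- divisors l | g \in divisors l)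
     (gcdn g d)%:R * (mobius (l %/ g))%:~R * z (N %/ (g %/ gcdn g d))%N).
  apply/funext => N; rewrite /partial_sum.
  under eq_bigr do rewrite ramanujan_sumE // /eratosthenes mulr_suml.
  rewrite exchange_big /= big_seq; apply: eq_bigr => g.
  rewrite -dvdn_divisors // => gl; have g0 := dvdn_gt0 l0 gl.
  have h0 : (0 < gcdn g d)%N by rewrite gcdn_gt0 g0.
  set e := (g %/ gcdn g d)%N.
  have e0 : (0 < e)%N by rewrite divn_gt0 // dvdn_leq // dvdn_gcdl.
  have gE : g = (gcdn g d * e)%N by rewrite mulnC divnK // dvdn_gcdl.
  (* As e divides the smooth number l, e m' is smooth exactly when m' is. *)
  have se : smooth V e.
    by apply: (@smooth_dvd V e l) sl; apply: dvdn_trans gl; rewrite gE dvdn_mull.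
  transitivity (\sum_(1 <= m < N.+1 | (e %| m)%N && smooth V m)
      g%:R * (mobius (l %/ g))%:~R / m%:R : R[i]).
    rewrite big_mkcond [RHS]big_mkcond; apply: eq_bigr => m _.
    rewrite dvdn_mul_gcd // -/e; case: (e %| m)%N; case: smooth => //=.
      by rewrite muln1.
    by rewrite muln0 !mul0r.
  rewrite sum_multiples_cond // /z /partial_sum mulr_sumr.
  apply: eq_big => m; first by rewrite smooth_mul se.
  move=> sm; rewrite {1}gE !natrM invfM.
  have eR : e%:R != 0 :> R[i] by rewrite pnatr_eq0 -lt0n.
  rewrite -!mulrA; congr (_ * _); rewrite mulrCA; congr (_ * _).
  by rewrite mulVKf.
have -> : (euler_factor R V)^-1 * (totient l * (l %| d))%:R =
   \sum_(g <- divisors l | g \in divisors l)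
     (gcdn g d)%:R * (mobius (l %/ g))%:~R * (euler_factor R V)^-1.
  by rewrite -eratosthenes_gcd // mulr_sumr -big_seq; apply: eq_bigr => g _; rewrite mulrC.
apply: cvgC_sum => g; rewrite -dvdn_divisors // => gl.
have g0 := dvdn_gt0 l0 gl.
apply: cvgC_mull; apply: (cvg_comp _ _ (cvg_divn _ _) (series_inv_smooth R V)).
by rewrite divn_gt0 ?gcdn_gt0 ?g0 // dvdn_leq // dvdn_gcdl.
Qed.

(** Insert F(t) as the sum of F'(d) over d | t and put t = d m; t is smooth exactly when d and m
    are. *)
Lemma sum_smooth_rearranged l N :
  \sum_(1 <= t < N.+1 | smooth V t) F t * c l t / t%:R =
  \sum_(1 <= d < N.+1) b d *
    \sum_(1 <= m < (N %/ d).+1 | smooth V m) c l (d * m) / m%:R.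
Proof.
transitivity (\sum_(1 <= t < N.+1) \sum_(d <- divisors t)
    (if smooth V t then eratosthenes F d * (c l t / t%:R) else 0)).
  rewrite big_mkcond big_nat [RHS]big_nat; apply: eq_bigr => t /andP[t0 _].
  case: ifP => _; last by rewrite big1.
  by rewrite -mulr_suml sum_eratosthenes // mulrA.
rewrite (sum_divisors_exchange _ (fun d t =>
  if smooth V t then eratosthenes F d * (c l t / t%:R) else 0)).
apply: eq_bigr => d _; rewrite mulr_sumr [RHS]big_mkcond; apply: eq_bigr => m _.
rewrite smooth_mul /b; case: (smooth V d); case: (smooth V m); rewrite ?mul0r //=.
by rewrite natrM invfM; ring.
Qed.

Lemma series_smooth_ramanujan l : smooth V l ->
  series_to (smooth V) (fun t => F t * c l t / t%:R)
    ((euler_factor R V)^-1 * ((totient l)%:R * B l)).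
Proof.
move=> sl; have l0 : (0 < l)%N by case/andP: sl.
pose cl : R := \sum_(g <- divisors l) g%:R.
have cl0 : 0 <= cl by apply: sumr_ge0.
pose y d N : R[i]^o := partial_sum (smooth V) (fun m => c l (d * m) / m%:R) N.
pose f N d := b d * y d (N %/ d)%N.
pose v d := b d * ((euler_factor R V)^-1 * (totient l * (l %| d))%:R).
have [||||T [vT limT]] := @tannery R nat \oo _ f v
  (partial_sum (smooth V) (fun t => F t * c l t / t%:R))
  (fun d => K * (cl * S) * smooth_rsqrt R V d).
- apply: (@bounded_sums_le _ _ (smooth_rsqrt R V) (K * (cl * S))) => //.
    by rewrite !mulr_ge0.
  exact: bounded_sums_rsqrt.
(* Since |c_l| <= [cl] and 1/m <= m^(-1/2), [y] is bounded by [cl * S] uniformly in d and in the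
   cut-off. *)
- apply: nearW => N d d0; rewrite /f Normc.normcM mulrAC.
  apply: ler_pM; rewrite ?normc_ge0 //.
  apply: le_trans (normc_sum _ _ _ _ _) _.
  apply: le_trans (ler_wpM2l cl0 (sumS (N %/ d))).
  rewrite mulr_sumr big_mkcond big_nat [leRHS]big_nat.
  apply: ler_sum => m /andP[m0 _]; rewrite /smooth_rsqrt.
  case: ifP => _; last by rewrite mulr0.
  rewrite Normc.normcM Normc.normcV normc_nat; apply: ler_pM => //.
  - exact: normc_ge0.
  - exact: normc_ramanujan_bound_l.
  - exact: inv_le_rsqrt.
- move=> d d0; apply: cvgC_mull.
  exact: (cvg_comp _ _ (cvg_divn d d0) (cvg_smooth_ramanujan l d sl d0)).
- apply: nearW => N; rewrite /partial_sum sum_smooth_rearranged.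
  apply: series_to_finite => d Nd.
  by rewrite /f /y /partial_sum divn_small // big_geq // mulr0.
suff <- : T = (euler_factor R V)^-1 * ((totient l)%:R * B l) by [].
rewrite -(series_to_sum _ _ _ _ vT); apply: series_to_sum.
rewrite mulrA /series_to.
(* Up to a constant factor, the indicator of l | d turns [v] into the series defining [B l]. *)
have := series_to_mull _ _ _ _ ((euler_factor R V)^-1 * (totient l)%:R)
  (series_to_coef l l0).
rewrite /series_to partial_sum_mkcond.
suff -> : (fun n => if (l %| n)%N
   then (euler_factor R V)^-1 * (totient l)%:R * b n else 0) = v by [].
apply/funext => d; rewrite /v natrM.
by case: (l %| d)%N; rewrite ?mulr0 // mulr1 mulrC.
Qed.

End SmoothCoefficients.
End Expansion.

(** * Deduction of (i)-(v) from the coefficient bounds and expansions *)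

Theorem theorem1 (R : realType) (F : nat -> R[i]) (V : nat)
  (hF : subpolynomial F) (hV : (1 < V)%N) :
  let FV := smooth_part F V in
  let c := @ramanujan_sum R in
  let A := fun l : nat =>
    euler_factor R V * ((totient l)%:R^-1 *
      series_sum (smooth V) (fun t => F t * c l t / t%:R)) in
  let P := fun l d : nat => smooth V d && (l %| d)%N in
  let B := fun l : nat =>
    series_sum (P l) (fun d => eratosthenes F d / d%:R) in
  [/\ (* (i) *)
      forall l : nat, (0 < l)%N ->
        [/\ Car_exists l FV, Win_exists l FV, Car l FV = Win l FV
          & ~~ smooth V l -> Car l FV = 0 /\ Win l FV = 0],
      (* (ii) *)
      (forall l : nat, (0 < l)%N ->
         finite_sum (smooth V) (fun t => Normc.normc (F t * c l t) / t%:R)) /\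
      (forall l : nat, smooth V l ->
         series_cvg (smooth V) (fun t => F t * c l t / t%:R) /\
         Car l FV = A l),
      (* (iii) *)
      (forall l : nat, smooth V l ->
         series_cvg (P l) (fun d => eratosthenes F d / d%:R)) /\
      (forall a : nat, (0 < a)%N ->
         [/\ series_to (smooth V) (fun l => A l * c l a) (FV a),
             series_to (smooth V) (fun l => B l * c l a) (FV a)
           & smooth V a ->
             series_to (smooth V) (fun l => A l * c l a) (F a) /\
             series_to (smooth V) (fun l => B l * c l a) (F a)]),
      (* (iv) *)
      finite_sum predT (fun l => 2 ^+ omega l * Normc.normc (Car l FV)) /\
      finite_sum predT (fun l => 2 ^+ omega l * Normc.normc (Win l FV))
    & (* (v) *)
      forall G : nat -> R[i],
        (forall a : nat, (0 < a)%N ->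
           series_to predT (fun l => G l * c l a) (FV a)) ->
        finite_sum predT (fun l => 2 ^+ omega l * Normc.normc (G l)) ->
        forall l : nat, (0 < l)%N -> G l = Car l FV /\ G l = Win l FV].
Proof.
move=> FV c A P B.
(* The growth condition is taken at eps = 1/2; division by d then leaves the summable d^(-1/2). *)
have [C FC] : exists C : R, forall n, (0 < n)%N ->
    Normc.normc (F n) <= C * Num.sqrt n%:R.
  have half0 : 0 < 2^-1 :> R by rewrite invr_gt0.
  have [C FC] := hF _ half0.
  by exists C => n n0; rewrite -powR12_sqrt ?ler0n //; apply: FC.
have C0 : 0 <= C.
  by have := FC 1%N isT; rewrite sqrtr1 mulr1; apply: le_trans; apply: normc_ge0.
pose K := C * 2 ^+ V; have K0 : 0 <= K by rewrite mulr_ge0 // exprn_ge0.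
have [S sumS] := bounded_sums_smooth_rsqrt R V.
have S0 : 0 <= S by have := sumS 0%N; rewrite big_geq.
have bK d : Normc.normc (if smooth V d then eratosthenes F d / d%:R else 0)
    <= K * smooth_rsqrt R V d.
  rewrite /smooth_rsqrt; case: ifP => sd; last by rewrite Normc.normc0 mulr0.
  rewrite Normc.normcM Normc.normcV normc_nat -sqrt_div mulrA.
  apply: ler_wpM2r; first by rewrite invr_ge0.
  exact: normc_eratosthenes.
have expB := expansion_smooth_part R F V K S K0 S0 sumS bK.
have sumB := bounded_sums_coef R F V K S K0 S0 sumS bK.
have nsB l : (0 < l)%N -> ~~ smooth V l -> B l = 0.
  exact: (coef_nsmooth R F V K S K0 sumS bK l).
(* The transform of the smooth part is F' cut to smooth d, so the two series agree already at each
   cut-off. *)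
have WinE l : partial_sum (fun d => (l %| d)%N)
     (fun d => eratosthenes FV d / d%:R) =
   partial_sum (P l) (fun d => eratosthenes F d / d%:R).
  apply/funext => N; rewrite /partial_sum big_nat_cond [RHS]big_nat_cond.
  rewrite big_mkcond [RHS]big_mkcond; apply: eq_bigr => d _.
  case: posnP => [->//|d0]; rewrite eratosthenes_smooth_part // /P.
  by case: (_ < _)%N; case: smooth; case: (_ %| _)%N; rewrite ?mul0r.
have WinB l : Win l FV = B l by rewrite /Win /series_sum WinE.
have cvgB l : (0 < l)%N -> series_cvg (P l) (fun d => eratosthenes F d / d%:R).
  move=> l0; apply/cvg_ex; exists (B l).
  have := series_to_coef R F V K S K0 sumS bK l l0.
  by rewrite /series_to -partial_sum_smooth_multiples.
have CarB l : (0 < l)%N -> Car_exists l FV /\ Car l FV = B l.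
  by move=> l0; apply: Car_expansion expB sumB.
have serA l := series_smooth_ramanujan R F V K S K0 S0 sumS bK l.
(* The Euler factor and the totient cancel against those produced by [serA]. *)
have AB l : smooth V l -> A l = B l.
  move=> sl; have l0 : (0 < l)%N by case/andP: sl.
  rewrite /A (series_to_sum _ _ _ _ (serA l sl)) mulrCA.
  rewrite [euler_factor _ _ * _]mulrA mulfV ?euler_factor_neq0 // mul1r.
  by rewrite mulKf // pnatr_eq0 -lt0n totient_gt0.
have sB a : (0 < a)%N -> series_to (smooth V) (fun l => B l * c l a) (FV a).
  move=> a0; have := expB a a0; rewrite /series_to [X in _ -> X @ _ --> _]partial_sum_mkcond.
  suff -> : partial_sum predT (fun l => B l * c l a) =
    partial_sum predT (fun l => if smooth V l then B l * c l a else 0) by [].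
  apply/funext => N; rewrite /partial_sum big_nat [RHS]big_nat.
  apply: eq_bigr => l /andP[l0 _]; case: ifP => // /negbT nsl.
  by rewrite nsB // mul0r.
have sA a : (0 < a)%N -> series_to (smooth V) (fun l => A l * c l a) (FV a).
  move=> a0; have := sB a a0; rewrite /series_to.
  suff -> : partial_sum (smooth V) (fun l => B l * c l a) =
    partial_sum (smooth V) (fun l => A l * c l a) by [].
  by apply/funext => N; apply: eq_bigr => l sl; rewrite AB.
have finB (X : nat -> R[i]) : (forall l, (0 < l)%N -> X l = B l) ->
    finite_sum predT (fun l => 2 ^+ omega l * Normc.normc (X l)).
  move=> XB; apply/finite_sum_bounded.
    by move=> n; rewrite mulr_ge0 ?exprn_ge0 ?normc_ge0.
  case: sumB => L bL; exists L => N; apply: le_trans (bL N).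
  rewrite big_nat [leRHS]big_nat; apply: ler_sum => l /andP[l0 _].
  by rewrite /= XB.
split.
- move=> l l0; have [Cex CE] := CarB l l0; rewrite CE WinB.
  split; [exact: Cex| |by []|by move=> nsl; rewrite nsB].
  by rewrite /Win_exists /series_cvg WinE; apply: cvgB.
- split=> [l l0|l sl]; last first.
    have l0 : (0 < l)%N by case/andP: sl.
    split; first by apply/cvg_ex; eexists; exact: serA sl.
    by rewrite (CarB l l0).2 AB.
  apply/finite_sum_bounded => [n|].
    by rewrite divr_ge0 ?ler0n ?normc_ge0.
  pose cl : R := \sum_(g <- divisors l) g%:R.
  have cl0 : 0 <= cl by apply: sumr_ge0.
  (* From |F(t)| <= C sqrt t and |c_l(t)| <= [cl], the terms are at most [C * cl] times t^(-1/2). *)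
  apply: (@bounded_sums_le _ _ (smooth_rsqrt R V) (C * cl)).
  + by rewrite mulr_ge0.
  + move=> n n0; rewrite /smooth_rsqrt; case: ifP => _; last by rewrite mulr0.
    rewrite -sqrt_div mulrA; apply: ler_wpM2r; first by rewrite invr_ge0.
    rewrite Normc.normcM mulrAC; apply: ler_pM; rewrite ?normc_ge0 ?FC //.
    exact: normc_ramanujan_bound_l.
  + by exists S.
- split=> [l /andP[l0 _]|a a0]; first exact: cvgB.
  split; [exact: sA|exact: sB|move=> sa].
  by rewrite -(smooth_part_smooth _ F V a sa); split; [apply: sA|apply: sB].
- by split; apply: finB => l l0; [apply: (CarB l l0).2|apply: WinB].
- move=> G GF /finite_sum_bounded bG l l0.
  have bG' : bounded_sums R (fun l => 2 ^+ omega l * Normc.normc (G l)).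
    by apply: bG => n; rewrite mulr_ge0 ?exprn_ge0 ?normc_ge0.
  (* Any such expansion has the Carmichael coefficients of [FV] as its coefficients, whence
     uniqueness. *)
  have [_ GE] := Car_expansion R G FV l l0 GF bG'.
  by rewrite -GE WinB (CarB l l0).2.
Qed.
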